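(* Consider the controlled partially observable piecewise deterministic Markov process and the associated discrete-time partially observable Markov decision model defined in the context. Let $x\in\mathbb R^d$ be an initial observation, let $\pi^P=(\pi^P_n)_{n\ge0}\in\Pi^P$ be a history dependent relaxed piecewise open loop policy and let $\pi^D=(\pi^D_n)_{n\ge0}\in\Pi^D$ be a corresponding discrete-time policy, i.e. for all $n\ge 0$ and all $h_n\in\mathcal H_n$, $\pi^P_n(h_n,t)=\pi^D_n(h_n)(t)$ for a.e. $t\ge0$. Then $$J(x,\pi^P)=\tilde J(x,\pi^D).$$
   Context: Standing assumptions: $A$ is a compact metric space; $\lambda^A:\mathbb R^d\times A\to(0,\infty)$ is continuous with $\underline\lambda\le\lambda^A\le\bar\lambda$ for constants $0<\underline\lambda\le\bar\lambda<\infty$; $Q^A$ is a transition kernel from $\mathbb R^d\times A$ to $\mathbb R^d$ which is weakly continuous, i.e. $(y,a)\mapsto\int v(z)Q^A(dz|y,a)$ is continuous and bounded for every continuous bounded $v$. $\mathcal P(A)$ is the set of Borel probability measures on $A$ with the weak topology. $\mathcal R$ is the set of measurable maps $r=(r_t)_{t\ge0}:[0,\infty)\to\mathcal P(A)$ (a.e. equal maps identified) with the Young topology ($r^n\to r$ iff $\int_0^\infty\int_A\psi(t,a)r^n_t(da)dt\to\int_0^\infty\int_A\psi(t,a)r_t(da)dt$ for all $\psi:[0,\infty)\times A\to\mathbb R$ measurable in $t$, continuous and bounded in $a$, with $\int_0^\infty\sup_a|\psi(t,a)|dt<\infty$) and its Borel $\sigma$-algebra. For each $r\in\mathcal R$,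 $\Phi^r:\mathbb R^d\times[0,\infty)\to\mathbb R^d$ is continuous with $\Phi^r(y,t+s)=\Phi^r(\Phi^r(y,s),t)$. $Q_\epsilon$ is a probability distribution on $\mathbb R^d$; $Q_0(\cdot|x)$ a transition kernel from $\mathbb R^d$ to $\mathbb R^d$ (law of $Y_0$ given observation $x$); $\beta\ge0$; $c:\mathbb R^d\times A\to[0,\infty)$ is measurable. All maps are jointly measurable as needed for the integrals below. $\Lambda^r(y,t)=\int_0^t\int_A\lambda^A(\Phi^r(y,u),a)r_u(da)du$, $\Gamma^r(y,t)=\beta t+\Lambda^r(y,t)$. Histories: $\mathcal H_0=\mathbb R^d$, $\mathcal H_n=\mathcal H_{n-1}\times\mathcal R\times[0,\infty)\times\mathbb R^d$, elements $h_n=(x_0,r_0,s_1,x_1,\dots,r_{n-1},s_n,x_n)$. $\Pi^P$: sequences of measurable maps $\pi_n^P:\mathcal H_n\times[0,\infty)\to\mathcal P(A)$. $\Pi^D$: sequences of measurable maps $\pi_n^D:\mathcal H_n\to\mathcal R$. Continuous-time process: for $\pi\in\Pi^P$ and $x,y\in\mathbb R^d$ there is a probability measure $\mathbb P^\pi_{x,y}$ carrying jump times $0=T_0<T_1<\dots$, post-jump states $\hat Y_n=Y_{T_n}$ and observations $X_n$, with $Y_0=y$, $X_0=x$ a.s. and, with $S_n=T_n-T_{n-1}$, $H_n=(X_0,\pi_0(H_0,\cdot),S_1,X_1,\dots,\pi_{n-1}(H_{n-1},\cdot),S_n,X_n)$ and $r=\pi_{n-1}(H_{n-1},\cdot)$,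 for $n\ge1$ the conditional probability of $\{S_n\le t,\hat Y_n\in C,X_n\in D\}$ given $(S_k,\hat Y_k,X_k)_{k\le n-1}$ and the past controls equals $$\int_0^te^{-\Lambda^r(\hat Y_{n-1},s)}\int_A\lambda^A(\Phi^r(\hat Y_{n-1},s),a)\int_CQ_\epsilon(D-y')Q^A(dy'|\Phi^r(\hat Y_{n-1},s),a)r_s(da)ds.$$ $Y_t=\Phi^{\pi_n(H_n,\cdot)}(\hat Y_n,t-T_n)$ and $\pi_t=\pi_n(H_n,t-T_n)$ for $T_n\le t<T_{n+1}$. Cost: $J(x,\pi)=\int\mathbb E^\pi_{x,y}\big[\int_0^\infty e^{-\beta t}\int_Ac(Y_t,a)\pi_t(da)dt\big]Q_0(dy|x)$. Discrete-time model: states $(s,y,x)\in[0,\infty)\times\mathbb R^{2d}$, actions $r\in\mathcal R$, substochastic transition law $$\tilde Q([0,t]\times C\times D|y,r)=\int_0^te^{-\Gamma^r(y,u)}\int_A\lambda^A(\Phi^r(y,u),a)\int_CQ_\epsilon(D-y')Q^A(dy'|\Phi^r(y,u),a)r_u(da)du,$$ one-stage cost $g(y,r)=\int_0^\infty e^{-\Gamma^r(y,t)}\int_Ac(\Phi^r(y,t),a)r_t(da)dt$. For $\pi\in\Pi^D$, $\tilde{\mathbb P}^\pi_x$ is the substochastic law of $(S_n,\hat Y_n,X_n)_n$ with $X_0=x$, $\hat Y_0\sim Q_0(\cdot|x)$ and, given the past, $(S_n,\hat Y_n,X_n)\sim\tilde Q(\cdot|\hat Y_{n-1},\pi_{n-1}(H_{n-1}))$,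 where $H_n=(X_0,\pi_0(H_0),S_1,X_1,\dots,\pi_{n-1}(H_{n-1}),S_n,X_n)$. $\tilde J(x,\pi)=\tilde{\mathbb E}^\pi_x\big[\sum_{k=0}^\infty g(\hat Y_k,\pi_k(H_k))\big]$, the sum over $k$ of the integrals of $g(\hat Y_k,\pi_k(H_k))$ with respect to the (substochastic) law of the first $k$ transitions. *)

(* Defs.v *)
From HB Require Import structures.
From mathcomp Require Import all_boot all_order all_algebra.
From mathcomp Require Import all_classical all_reals all_analysis.

Set Implicit Arguments.
Unset Strict Implicit.
Unset Printing Implicit Defensive.

Import Order.TTheory GRing.Theory Num.Theory.
Import numFieldNormedType.Exports.

Local Open Scope classical_set_scope.
Local Open Scope ring_scope.

(* MathComp-Analysis measurable types are pointed, hence the base point on the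
   action space. *)
#[short(type="pmetricType")]
HB.structure Definition PointedMetric (K : numDomainType) :=
  { M of Metric K M & isPointed M }.

Definition borel (T : ptopologicalType) :
    measurableType (sigma_display (@open T)) :=
  g_sigma_algebraType (@open T).

Definition leb {R : realType} : {measure set (measurableTypeR R) -> \bar R} :=
  lebesgue_measure.

Definition Rge0 {R : realType} : set (measurableTypeR R) := [set t : R | 0 <= t].

Definition state (R : realType) (d : nat) := borel 'rV[R]_d.

Section RelaxedControls.
Context {R : realType} (A : pmetricType R).

(* The weak topology on probability measures: the coarsest one making
   mu |-> \int f dmu continuous for all bounded continuous f. *)
Record bcont := BCont {
  bcont_fun :> A -> R ;
  bcont_continuous : continuous bcont_fun ;
  bcont_bounded : exists K : R, forall a, `|bcont_fun a| <= K }.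

HB.instance Definition _ := gen_eqMixin bcont.

Definition weak_eval (mu : probability (borel A) R) :
  {ptws bcont -> R} := fun f => (\int[mu]_a f a)%R.

HB.instance Definition _ := Pointed.copy (initial_topology weak_eval)
  (probability (borel A) R).

Definition probA := borel (initial_topology weak_eval).

Record control := Control {
  control_fun :> measurableTypeR R -> probA ;
  control_measurable : measurable_fun Rge0 control_fun }.

Definition const_control : control :=
  Control (@measurable_cst _ _ _ _ Rge0 (point : probA)).

HB.instance Definition _ := gen_eqMixin control.
HB.instance Definition _ := gen_choiceMixin control.
HB.instance Definition _ := isPointed.Build control const_control.

(* Library measures are functions on all sets, measurable or not; equality in
   P(A) is therefore equality on measurable sets. *)
Definition control_eq (r r' : R -> probA) : Prop :=
  {ae leb, forall t, Rge0 t ->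
    forall B : set (borel A), measurable B -> r t B = r' t B}.

Definition control_eqb (r r' : control) : bool := `[< control_eq r r' >].

Lemma control_eqb_refl : reflexive control_eqb.
Proof. by move=> r; apply/asboolP; exact: aeW. Qed.

Lemma control_eqb_sym : symmetric control_eqb.
Proof.
suff h r r' : control_eqb r r' -> control_eqb r' r.
  by move=> r r'; apply/idP/idP; exact: h.
move=> /asboolP e; apply/asboolP.
by apply: filterS e => t + t0 B mB => ->.
Qed.

Lemma control_eqb_trans : transitive control_eqb.
Proof.
move=> r2 r1 r3 /asboolP e12 /asboolP e23; apply/asboolP.
by apply: filterS2 e12 e23 => t h12 h23 t0 B mB; rewrite h12// h23.
Qed.

Canonical control_equiv :=
  EquivRel control_eqb control_eqb_refl control_eqb_sym control_eqb_trans.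

Definition control_quot : Type := {eq_quot control_eqb}%qT.
HB.instance Definition _ := Choice.on control_quot.
HB.instance Definition _ := EqQuotient.on control_quot.
HB.instance Definition _ := isPointed.Build control_quot
  (\pi_control_quot (point : control))%qT.

Record young_fun := YoungFun {
  yfun :> measurableTypeR R -> A -> R ;
  yfun_measurable : forall a, measurable_fun Rge0 (yfun ^~ a) ;
  yfun_continuous : forall t, 0 <= t -> continuous (yfun t) ;
  yfun_bounded : forall t, 0 <= t -> exists K : R, forall a, `|yfun t a| <= K ;
  yfun_integrable : (\int[leb]_(t in Rge0)
    ereal_sup [set `|yfun t a|%:E | a in [set: A]] < +oo)%E }.

HB.instance Definition _ := gen_eqMixin young_fun.

Definition young_eval (r : control_quot) : {ptws young_fun -> R} :=
  fun psi => (\int[leb]_(t in Rge0) \int[(repr r : control) t]_a psi t a)%R.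

HB.instance Definition _ := Pointed.copy (initial_topology young_eval)
  control_quot.

(* The space of relaxed controls, with the Borel sets of the Young topology. *)
Definition relaxed := borel (initial_topology young_eval).

(* A representative of a class of relaxed controls. *)
Definition ctrl (r : relaxed) : R -> probA := (repr (r : control_quot) : control).

(* The class of a measurable map Rge0 -> P(A) (a default if not measurable). *)
Definition relaxed_of (f : measurableTypeR R -> probA) : relaxed :=
  match pselect (measurable_fun Rge0 f) with
  | left mf => (\pi_control_quot (Control mf))%qT
  | right _ => point
  end.

End RelaxedControls.

Record pdmdp (R : realType) (d : nat) (A : pmetricType R) := Pdmdp {
  lamA : 'rV[R]_d * A -> R ;
  lamA_continuous : continuous lamA ;
  lamA_bounds : exists lo hi : R,
    [/\ 0 < lo, lo <= hi & forall ya, lo <= lamA ya <= hi] ;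
  QA : R.-pker (state R d * borel A) ~> state R d ;
  QA_weakly_continuous : forall v : 'rV[R]_d -> R, continuous v ->
    (exists K : R, forall z, `|v z| <= K) ->
    continuous (fun ya : 'rV[R]_d * A => (\int[QA ya]_z v z)%R) /\
    exists K : R, forall ya, `|(\int[QA ya]_z v z)%R| <= K ;
  Phi : relaxed A -> 'rV[R]_d * R -> 'rV[R]_d ;
  Phi_continuous : forall r,
    {within [set yt | 0 <= yt.2], continuous (Phi r)} ;
  Phi_flow : forall r y (s t : R), 0 <= s -> 0 <= t ->
    Phi r (y, t + s) = Phi r (Phi r (y, s), t) ;
  Phi_measurable : measurable_fun ([set: relaxed A * state R d] `*` Rge0)
    (fun z : (relaxed A * state R d) * measurableTypeR R =>
      Phi z.1.1 (z.1.2, z.2) : state R d) ;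
  Qeps : probability (state R d) R ;
  Q0 : R.-pker (state R d) ~> state R d ;
  discount : R ;
  discount_ge0 : 0 <= discount ;
  cost : state R d * borel A -> R ;
  cost_measurable : measurable_fun [set: state R d * borel A] cost ;
  cost_ge0 : forall ya, 0 <= cost ya }.

Section Model.
Context {R : realType} {d : nat} {A : pmetricType R} (M : pdmdp d A).
Local Notation E := (state R d).
Local Notation time := (measurableTypeR R).

Definition Lambda (r : relaxed A) (y : E) (t : R) : R :=
  (\int[leb]_(u in [set u : R | 0 <= u <= t])
     \int[ctrl r u]_a lamA M (Phi M r (y, u), a))%R.

Definition Gamma (r : relaxed A) (y : E) (t : R) : R :=
  discount M * t + Lambda r y t.

(* With G = Lambda r y this is the conditional law of (S_n, Yhat_n, X_n) in
   the continuous-time process; with G = Gamma r y it is the value of Qtilde on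
   [0, t] x C x D; the set below is D - y'. *)
Definition jump_law (G : R -> R) (r : relaxed A) (y : E)
    (t : R) (C D : set E) : \bar R :=
  (\int[leb]_(u in [set u : R | (0 <= u <= t)%R])
     ((expR (- G u))%:E *
      \int[ctrl r u]_a
        ((lamA M (Phi M r (y, u), a))%:E *
         \int[QA M (Phi M r (y, u), a)]_(y' in C)
            Qeps M [set (z - y' : 'rV[R]_d)%R | z in D])))%E.

(* The measure Qtilde(. | y, r) as a set function: its values on rectangles,
   which determine it, are computed in Qtilde_rect. *)
Definition Qtilde (y : E) (r : relaxed A) (B : set (time * (E * E))) : \bar R :=
  (\int[leb]_(u in Rge0)
     ((expR (- Gamma r y u))%:E *
      \int[ctrl r u]_a
        ((lamA M (Phi M r (y, u), a))%:E *
         \int[QA M (Phi M r (y, u), a)]_y'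
            Qeps M [set (z - y' : 'rV[R]_d)%R | z in [set z | B (u, (y', z))]])))%E.

Definition stage_cost (y : E) (r : relaxed A) : \bar R :=
  (\int[leb]_(t in Rge0)
     ((expR (- Gamma r y t))%:E *
      \int[ctrl r t]_a (cost M (Phi M r (y, t), a))%:E))%E.

Lemma Qtilde_rect (y : E) (r : relaxed A) (t : R) (C D : set E) :
  Qtilde y r ([set u : R | 0 <= u <= t] `*` (C `*` D)) =
  jump_law (Gamma r y) r y t C D.
Proof.
rewrite /Qtilde /jump_law.
rewrite [RHS]integral_mkcond [LHS]integral_mkcond; apply: eq_integral => u _.
rewrite !patchE; case: ifPn => u0; last first.
  rewrite ifF//; apply/negbTE; apply: contra u0; rewrite !inE.
  by move=> /= /andP[].
case: ifPn => ut; last first.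
  rewrite (@eq_integral _ _ _ _ _ (cst 0%E)) ?integral0 ?mule0// => a _ /=.
  rewrite (@eq_integral _ _ _ _ _ (cst 0%E)) ?integral0 ?mule0// => y' _ /=.
  rewrite (_ : [set _ | z in _] = set0) ?measure0//.
  rewrite -subset0 => _ [z [/= ht _] _].
  by move: ut; rewrite notin_setE.
congr (_ * _)%E; apply: eq_integral => a _; congr (_ * _)%E.
rewrite [RHS]integral_mkcond; apply: eq_integral => y' _.
rewrite patchE; case: ifPn => yC.
  congr (Qeps M _); apply/seteqP; split => _ [z zD <-].
    by exists z => //; move: zD => [] _ [].
  by exists z => //; split => //=; [move: ut; rewrite inE|split => //; rewrite inE in yC].
rewrite (_ : [set _ | z in _] = set0) ?measure0//.
rewrite -subset0 => _ [z [/= _ [hC _]] _].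
by move: yC; rewrite notin_setE.
Qed.

End Model.

Section Histories.
Context {R : realType} (d : nat) (A : pmetricType R).
Local Notation E := (state R d).
Local Notation time := (measurableTypeR R).
Local Open Scope measure_display_scope.

Fixpoint hist_display (n : nat) : measure_display :=
  match n with
  | 0 => (@open 'rV[R]_d).-sigma
  | m.+1 => (((hist_display m, (@open (initial_topology (@young_eval R A))).-sigma).-prod,
      (R.-ocitv.-measurable).-sigma).-prod, (@open 'rV[R]_d).-sigma).-prod
  end.

Fixpoint hist (n : nat) : measurableType (hist_display n) :=
  match n return measurableType (hist_display n) with
  | 0 => E
  | m.+1 => (hist m * relaxed A * time * E)%type
  end.

(* Sojourn times have type R; the space H_n consists of the histories whose
   sojourn times are nonnegative. *)
Fixpoint hist_space (n : nat) : set (hist n) :=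
  match n return set (hist n) with
  | 0 => setT
  | m.+1 => [set h | hist_space h.1.1.1 /\ 0 <= h.1.2]
  end.

Record policyP := PolicyP {
  policyP_fun :> forall n, hist n * time -> probA A ;
  policyP_measurable : forall n,
    measurable_fun (@hist_space n `*` Rge0) (@policyP_fun n) }.

Record policyD := PolicyD {
  policyD_fun :> forall n, hist n -> relaxed A ;
  policyD_measurable : forall n, measurable_fun (@hist_space n) (@policyD_fun n) }.

Arguments policyP_fun : clear implicits.
Arguments policyD_fun : clear implicits.

Definition corresponding (p : policyP) (q : policyD) : Prop :=
  forall n (h : hist n), hist_space h ->
    control_eq (fun t => p n (h, t)) (ctrl (q n h)).

Fixpoint traj_display (n : nat) : measure_display :=
  match n with
  | 0 => ((@open 'rV[R]_d).-sigma, (@open 'rV[R]_d).-sigma).-prod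
  | m.+1 => (traj_display m, ((R.-ocitv.-measurable).-sigma,
      ((@open 'rV[R]_d).-sigma, (@open 'rV[R]_d).-sigma).-prod).-prod).-prod
  end.

(* ((yhat_0, x_0), (s_1, (yhat_1, x_1)), ..., (s_n, (yhat_n, x_n))) *)
Fixpoint traj (n : nat) : measurableType (traj_display n) :=
  match n return measurableType (traj_display n) with
  | 0 => (E * E)%type
  | m.+1 => (traj m * (time * (E * E)))%type
  end.

Definition traj_last (n : nat) : traj n -> E :=
  match n return traj n -> E with
  | 0 => fun w => w.1
  | m.+1 => fun w => w.2.2.1
  end.

Fixpoint traj_hist (q : policyD) (n : nat) : traj n -> hist n :=
  match n return traj n -> hist n with
  | 0 => fun w => w.2
  | m.+1 => fun w => let h := traj_hist q w.1 in (h, q m h, w.2.1, w.2.2.2)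
  end.

End Histories.

Section Process.
Context {R : realType} {d : nat} {A : pmetricType R} (M : pdmdp d A).
Context (p : policyP d A).
Context {dO : measure_display} {Omega : measurableType dO}.
Context (T : nat -> Omega -> R) (Yh X : nat -> Omega -> state R d).

Definition sojourn (n : nat) (w : Omega) : R := T n.+1 w - T n w.

(* H_n; its component of index n is the class of pi_n(H_n, .) in the space of
   relaxed controls. *)
Fixpoint Hproc (n : nat) (w : Omega) : hist d A n :=
  match n return hist d A n with
  | 0 => X 0%N w
  | m.+1 => (Hproc m w, relaxed_of (fun t => p m (Hproc m w, t)),
             sojourn m w, X m.+1 w)
  end.

Definition Rproc (n : nat) (w : Omega) : relaxed A :=
  relaxed_of (fun t => p n (Hproc n w, t)).

(* The n with T_n <= t < T_{n+1} (0 beyond an explosion time). *)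
Definition jump_index (w : Omega) (t : R) : nat :=
  xget 0%N [set n | T n w <= t < T n.+1 w].

Definition Yproc (w : Omega) (t : R) : state R d :=
  let n := jump_index w t in Phi M (Rproc n w) (Yh n w, t - T n w).

Definition piproc (w : Omega) (t : R) : probA A :=
  let n := jump_index w t in p n (Hproc n w, t - T n w).

(* (S_k, Yhat_k, X_k)_{k <= n} and the controls chosen before T_n. *)
Definition past (n : nat) (w : Omega) :
    (hist d A n * n.+1.-tuple (state R d))%type :=
  (Hproc n w, [tuple Yh k w | k < n.+1]).

Record is_pdmdp_process (x y : state R d) (P : probability Omega R) : Prop := {
  T_measurable : forall n,
    measurable_fun [set: Omega] (T n : Omega -> measurableTypeR R) ;
  Yh_measurable : forall n, measurable_fun [set: Omega] (Yh n) ;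
  X_measurable : forall n, measurable_fun [set: Omega] (X n) ;
  T_zero : forall w, T 0%N w = 0 ;
  T_increasing : forall n w, T n w < T n.+1 w ;
  post_jump : forall n w, Yh n w = Yproc w (T n w) ;
  Y_init : {ae P, forall w, Yproc w 0 = y} ;
  X_init : {ae P, forall w, X 0%N w = x} ;
  (* conditional probability given the sigma-algebra generated by the past *)
  jump_cond : forall n (B : set (hist d A n * n.+1.-tuple (state R d)))
    (t : R) (C D : set (state R d)),
    measurable B -> 0 <= t -> measurable C -> measurable D ->
    P (past n @^-1` B `&`
       [set w | [/\ sojourn n w <= t, C (Yh n.+1 w) & D (X n.+1 w)]]) =
    (\int[P]_(w in past n @^-1` B)
       jump_law M (Lambda M (Rproc n w) (Yh n w)) (Rproc n w) (Yh n w) t C D)%E }.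

End Process.

Definition J (R : realType) (d : nat) (A : pmetricType R) (M : pdmdp d A)
    (p : policyP d A) (dO : measure_display) (Omega : measurableType dO)
    (T : nat -> Omega -> R) (Yh X : nat -> Omega -> state R d)
    (P : state R d -> state R d -> probability Omega R)
    (x : state R d) : \bar R :=
  (\int[Q0 M x]_y \int[P x y]_w \int[leb]_(t in Rge0)
     ((expR (- (discount M * t)))%:E *
      \int[piproc p T X w t]_a (cost M (Yproc M p T Yh X w t, a))%:E))%E.

Section DiscreteTimeModel.
Context {R : realType} {d : nat} {A : pmetricType R} (M : pdmdp d A).
Context (q : policyD d A).

(* The substochastic law of (Yhat_0, X_0) and the first n transitions, as a set
   function, which is all that the library integral takes. *)
Fixpoint traj_law (x : state R d) (n : nat) : set (@traj R d n) -> \bar R :=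
  match n return set (@traj R d n) -> \bar R with
  | 0 => fun B => Q0 M x [set y | B (y, x)]
  | m.+1 => fun B => (\int[@traj_law x m]_w
      Qtilde M (traj_last w) (q m (traj_hist q w)) [set z | B (w, z)])%E
  end.

Definition Jtilde (x : state R d) : \bar R :=
  (\sum_(0 <= k <oo) \int[@traj_law x k]_w
     stage_cost M (traj_last w) (q k (traj_hist q w)))%E.

End DiscreteTimeModel.

(* Main.v *)
(** Both costs are written as the sum over n of E[e^{-beta T_n} g_n(h_n)], where h_n is the
    trajectory (Yhat_0, X_0), (S_1, Yhat_1, X_1), ..., (S_n, Yhat_n, X_n) and g_n is the one-stage
    cost. By the conditional jump law, the trajectory extended by one jump is distributed under
    P_{x,y} as the image of h_n under a kernel that becomes Qtilde when weighted
    by e^{-beta S_{n+1}}; integrating along these kernels accounts for the factor e^{-beta T_n}. The cost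
    accumulated on [T_n, T_{n+1}) is turned into g_n by Tonelli's theorem and
    P(S_{n+1} > u | h_n) = e^{-Lambda(u)}. The intensity is bounded, so
    E e^{-T_{n+1}} <= kappa E e^{-T_n} with kappa < 1 and the process does not explode. Relaxed
    controls are only known up to null sets in t, so the jointly measurable representative given
    by the piecewise open loop policy replaces them inside all time integrals. *)

Require Import Defs.
From HB Require Import structures.
From mathcomp Require Import all_boot all_order all_algebra.
From mathcomp Require Import all_classical all_reals all_analysis.
From mathcomp Require Import measurable_realfun ring lra.

Set Implicit Arguments.
Unset Strict Implicit.
Unset Printing Implicit Defensive.

Import Order.TTheory GRing.Theory Num.Theory.
Import numFieldNormedType.Exports.

Local Open Scope classical_set_scope.
Local Open Scope ring_scope.

(** The obstacle is measurability. [ctrl] picks a representative of each class separately, so the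
    integrands of [stage_cost], [Qtilde] and [jump_law] are not known to be jointly measurable in
    trajectory and time; [traj_law] is only a set function; and the cost of a path is not known to
    be measurable in the sample point. Integrals of nonnegative functions are therefore moved
    between these definitions and genuine kernels by almost everywhere equality, which preserves the
    integral even when measurability is unknown. The comparison is available only on trajectories
    with nonnegative sojourn times, so concentration on these is carried through the induction. The
    kernel of one stage is built once, over an abstract parameter space [W] and with a discount rate
    [b]. For [b] = 0 it is the probability kernel of the process, for [b = discount M] the
    substochastic [Qtilde]; the two differ by the density e^{-b u}. Both costs are then compared for
    each fixed initial state y, under the integral over [Q0]. *)

(** * Integrals against set functions and of functions without measurability *)

Section set_function_integral.
Local Open Scope ereal_scope.
Context dT (T : measurableType dT) (R : realType).
Import HBNNSimple.

Let eq_nnintegral (m1 m2 : set T -> \bar R) (f : T -> \bar R) :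
  (forall B, measurable B -> m1 B = m2 B) ->
  [set sintegral m1 h | h in [set h : {nnsfun T >-> R} | forall x, (h x)%:E <= f x]] `<=`
  [set sintegral m2 h | h in [set h : {nnsfun T >-> R} | forall x, (h x)%:E <= f x]].
Proof.
move=> m12 _ [h hf <-] /=; exists h => //; apply: eq_fsbigr => r _.
by rewrite m12.
Qed.

(** The integral is a supremum over simple functions, and these query the set function on measurable
    sets only. This allows [traj_law] to be replaced by a true measure. *)
Lemma eq_setfun_integral (m1 m2 : set T -> \bar R) (D : set T) (f : T -> \bar R) :
  (forall B, measurable B -> m1 B = m2 B) ->
  \int[m1]_(x in D) f x = \int[m2]_(x in D) f x.
Proof.
move=> m12; rewrite /integral.
by congr (ereal_sup _ - ereal_sup _); rewrite eqEsubset; split;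
  apply: eq_nnintegral => B mB; rewrite m12.
Qed.

Variable mu : {measure set T -> \bar R}.

(** A simple function below f, set to 0 on the exceptional null set, is below g and has the same
    integral; so the suprema compare although neither f nor g is measurable. *)
Let ge0_ae_le_integralT (f g : T -> \bar R) :
  (forall x, 0 <= f x) -> (forall x, 0 <= g x) ->
  {ae mu, forall x, f x <= g x} -> \int[mu]_x f x <= \int[mu]_x g x.
Proof.
move=> f0 g0 [N [mN N0 fgN]].
rewrite ge0_integralTE// [leRHS]ge0_integralTE//.
apply: ge_ereal_sup => _ [h /= hf <-].
apply: ereal_sup_ubound => /=.
exists (proj_nnsfun h (measurableC mN)) => [x|].
  rewrite /proj_nnsfun/= mindicE.
  have [xN|xN] := boolP (x \in ~` N); last by rewrite mulr0.
  rewrite mulr1; apply: (le_trans (hf x)).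
  apply: contrapT => fgx; move: xN; rewrite inE /=; apply; exact: fgN.
rewrite -!integralT_nnsfun.
apply: ge0_ae_eq_integral => //.
- exact/measurable_EFinP.
- exact/measurable_EFinP.
- by move=> x _; rewrite lee_fin.
- by move=> x _; rewrite lee_fin.
exists N; split => // x /= H; apply: contrapT => xN; apply: H => _.
by rewrite /= mindicE mem_set// mulr1.
Qed.

Lemma ge0_ae_eq_integral_nonmeas (D : set T) (f g : T -> \bar R) :
  (forall x, D x -> 0 <= f x) -> (forall x, D x -> 0 <= g x) ->
  {ae mu, forall x, D x -> f x = g x} ->
  \int[mu]_(x in D) f x = \int[mu]_(x in D) g x.
Proof.
move=> f0 g0 fg; rewrite integral_mkcond [RHS]integral_mkcond.
apply/eqP; rewrite eq_le; apply/andP; split; apply: ge0_ae_le_integralT.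
- exact: erestrict_ge0.
- exact: erestrict_ge0.
- apply: filterS fg => x fg; rewrite !patchE; case: ifPn => // /set_mem Dx.
  by rewrite fg.
- exact: erestrict_ge0.
- exact: erestrict_ge0.
- apply: filterS fg => x fg; rewrite !patchE; case: ifPn => // /set_mem Dx.
  by rewrite fg.
Qed.

End set_function_integral.

Lemma measurable_Rge0 {R : realType} : measurable (Rge0 : set (measurableTypeR R)).
Proof. by rewrite /Rge0 -set_itvcy; exact: measurable_itv. Qed.

(** * Kernels obtained by precomposition, from a constant measure, and by scaling *)

Section kernel_constructions.
Local Open Scope ereal_scope.
Context dX (X : measurableType dX) dY (Y : measurableType dY)
  dZ (Z : measurableType dZ) (R : realType).

Section kprecomp.
Variables (k : R.-ker Y ~> Z) (f : X -> Y) (mf : measurable_fun setT f).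

(** The proof of measurability is an argument so that the kernel structure can be inferred from the
    term alone; [kscale] and [kprobA] follow the same pattern. *)
Definition kprecomp of measurable_fun setT f : X -> {measure set Z -> \bar R} :=
  fun x => k (f x).

Let measurable_kprecomp U : measurable U ->
  measurable_fun setT (kprecomp mf ^~ U).
Proof. by move=> mU; exact: measurableT_comp (measurable_kernel k U mU) mf. Qed.

HB.instance Definition _ := isKernel.Build _ _ X Z R (kprecomp mf) measurable_kprecomp.
End kprecomp.

Section kprecomp_finite.
Variables (k : R.-fker Y ~> Z) (f : X -> Y) (mf : measurable_fun setT f).

Let kprecomp_uub : measure_fam_uub (kprecomp k mf).
Proof. by have [r kr] := measure_uub k; exists r => x; exact: kr. Qed.

HB.instance Definition _ :=
  Kernel_isFinite.Build _ _ X Z R (kprecomp k mf) kprecomp_uub.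
End kprecomp_finite.

Section kprecomp_sfinite.
Variables (k : R.-sfker Y ~> Z) (f : X -> Y) (mf : measurable_fun setT f).

(** A second name for [kprecomp], which keeps the s-finite instance apart from the finite one;
    likewise [sfkconst] for [kconst]. *)
Definition sfkprecomp of measurable_fun setT f : X -> {measure set Z -> \bar R} :=
  fun x => k (f x).

HB.instance Definition _ := Kernel.copy (sfkprecomp mf) (kprecomp k mf).

Let kprecomp_sfinite : exists s : (R.-fker X ~> Z)^nat,
  forall x U, measurable U -> sfkprecomp mf x U = kseries s x U.
Proof.
have [s sk] := sfinite_kernel k.
by exists (fun n => kprecomp (s n) mf) => x U mU; rewrite /sfkprecomp sk.
Qed.

HB.instance Definition _ :=
  Kernel_isSFinite.Build _ _ X Z R (sfkprecomp mf) kprecomp_sfinite.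
End kprecomp_sfinite.

Definition kconst (m : {measure set Z -> \bar R}) (x : X) : {measure set Z -> \bar R} := m.

Section kconst.
Variable m : {measure set Z -> \bar R}.

Let measurable_kconst U : measurable U -> measurable_fun setT (kconst m ^~ U).
Proof. by move=> mU; exact: measurable_cst. Qed.
HB.instance Definition _ := isKernel.Build _ _ X Z R (kconst m) measurable_kconst.
End kconst.

Section kconst_finite.
Variable m : {finite_measure set Z -> \bar R}.
Let kconst_uub : measure_fam_uub (kconst m).
Proof.
have fm := fin_num_measure m _ measurableT.
exists (fine (m setT) + 1)%R => x.
by rewrite EFinD fineK// /kconst lteDl.
Qed.
HB.instance Definition _ := Kernel_isFinite.Build _ _ X Z R (kconst m) kconst_uub.
End kconst_finite.

Definition sfkconst (m : {sfinite_measure set Z -> \bar R}) (x : X) :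
  {measure set Z -> \bar R} := m.

Section kconst_sfinite.
Variable m : {sfinite_measure set Z -> \bar R}.

HB.instance Definition _ := Kernel.copy (sfkconst m) (kconst m).
Let kconst_sfinite : exists s : (R.-fker X ~> Z)^nat,
  forall x U, measurable U -> sfkconst m x U = kseries s x U.
Proof.
exists (fun n => kconst (sfinite_measure_seq m n)) => x U mU.
exact: sfinite_measure_seqP.
Qed.
HB.instance Definition _ :=
  Kernel_isSFinite.Build _ _ X Z R (sfkconst m) kconst_sfinite.
End kconst_sfinite.

Section kscale.
Variables (k : R.-fker X ~> Z) (g : X -> {nonneg R}) (hi : R).
Hypothesis mg : measurable_fun setT (fun x => (g x)%:num : R).
Hypothesis ghi : forall x, ((g x)%:num <= hi)%R.

Definition kscale (k : R.-fker X ~> Z) (g : X -> {nonneg R})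
  (mg : measurable_fun setT (fun x => (g x)%:num : R))
  (ghi : forall x, ((g x)%:num <= hi)%R) (x : X) :
  {measure set Z -> \bar R} := mscale (g x) (k x).

Let measurable_kscale U : measurable U -> measurable_fun setT (kscale k mg ghi ^~ U).
Proof.
move=> mU; rewrite /kscale /= /mscale.
apply: emeasurable_funM; first exact/measurable_EFinP.
exact: measurable_kernel.
Qed.

HB.instance Definition _ := isKernel.Build _ _ X Z R (kscale k mg ghi) measurable_kscale.

Let kscale_uub : measure_fam_uub (kscale k mg ghi).
Proof.
have [r kr] := measure_uub k; exists (hi * r + 1)%R => x.
rewrite /kscale /= /mscale; apply: (@le_lt_trans _ _ (hi * r)%:E); last first.
  by rewrite lte_fin ltrDl.
rewrite EFinM; apply: lee_pmul => //; first by rewrite lee_fin.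
exact: ltW.
Qed.

HB.instance Definition _ := Kernel_isFinite.Build _ _ X Z R (kscale k mg ghi) kscale_uub.
End kscale.

End kernel_constructions.

(** * Uniqueness of finite measures from their values on a pi-system *)

Section measure_uniqueness.
Local Open Scope ereal_scope.

Lemma prod_measure_unique d1 d2 (T1 : measurableType d1) (T2 : measurableType d2)
    (R : realType) (m1 m2 : {measure set (T1 * T2) -> \bar R}) :
  m1 setT < +oo ->
  (forall B C, measurable B -> measurable C -> m1 (B `*` C) = m2 (B `*` C)) ->
  forall B, measurable B -> m1 B = m2 B.
Proof.
move=> m1oo m12 B mB.
apply: (measure_unique [set X `*` Y | X in measurable & Y in measurable]
  (fun=> setT)) => //.
- exact: measurable_prod_measurableType.
- move=> _ _ [X1 mX1 [Y1 mY1 <-]] [X2 mX2 [Y2 mY2 <-]].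
  exists (X1 `&` X2); first exact: measurableI.
  exists (Y1 `&` Y2); first exact: measurableI.
  by rewrite setXI.
- by move=> _; exists setT => //; exists setT => //; rewrite setXTT.
- by rewrite bigcup_const.
- by move=> _ [X mX [Y mY <-]]; exact: m12.
Qed.

(** Closed left rays are the generator that fits the jump law, whose time variable is known only
    through the events S <= t. *)
Lemma ray_measure_unique (R : realType)
    (m1 m2 : {measure set (measurableTypeR R) -> \bar R}) :
  m1 setT < +oo ->
  (forall t : R, m1 `]-oo, t]%classic = m2 `]-oo, t]%classic) ->
  forall B, measurable B -> m1 B = m2 B.
Proof.
move=> m1oo m12 B mB.
apply: (@measure_unique _ R (measurableTypeR R) [set X : set (measurableTypeR R) | exists t
    : R, X = `]-oo, t]%classic]
  (fun n => `]-oo, n%:R]%classic)) => //.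
- rewrite -[LHS]/((@ocitv R).-sigma.-measurable).
  rewrite RGenOInfty.measurableE; apply/seteqP; split.
    apply: smallest_sub; first exact: smallest_sigma_algebra.
    move=> _ [x ->]; rewrite -setCitvl.
    apply: (@measurableC _ (g_sigma_algebraType
      [set X : set R | exists t : R, X = `]-oo, t]%classic])).
    by apply: sub_sigma_algebra; exists x.
  apply: smallest_sub; first exact: smallest_sigma_algebra.
  move=> _ [x ->]; rewrite -setCitvr.
  apply: measurableC.
  by apply: sub_sigma_algebra; exists x.
- move=> _ _ [s ->] [t ->]; exists (Num.min s t).
  apply/seteqP; split => x /=; rewrite !in_itv/= le_min.
    by move=> [-> ->].
  by move=> /andP[].
- by move=> n; exists n%:R.
- apply/seteqP; split => // x _ /=.
  have [n xn] : exists n : nat, (x <= n%:R)%R.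
    exists (Num.truncn `|x|).+1; apply: (le_trans (ler_norm x)).
    exact/ltW/truncnS_gt.
  by exists n => //=; rewrite in_itv.
- by move=> _ [t ->]; exact: m12.
- by move=> n; apply: le_lt_trans m1oo; apply: le_measure => //; rewrite inE.
Qed.

End measure_uniqueness.

(** * Image measures and translation invariance of Lebesgue measure *)

Section pushforward_bundled.
Local Open Scope ereal_scope.
Context d d' (T : measurableType d) (U : measurableType d') (R : realType).
Variables (m : {measure set T -> \bar R}) (f : T -> U) (mf : measurable_fun setT f).

Definition pushm : {measure set U -> \bar R}.
Proof. unshelve refine (pushforward m f : {measure set U -> \bar R}); exact mf. Defined.

Lemma pushmE B : pushm B = m (f @^-1` B). Proof. by []. Qed.

Lemma ge0_integral_pushm (g : U -> \bar R) : measurable_fun setT g ->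
  (forall y, 0 <= g y) -> \int[pushm]_y g y = \int[m]_x g (f x).
Proof.
by move=> mg g0; rewrite (ge0_integral_pushforward mf)// => y _; exact: g0.
Qed.

End pushforward_bundled.

Section translation.
Local Open Scope ereal_scope.
Context {R : realType}.

Lemma lebesgue_measure_translation (a : R) (B : set R) : measurable B ->
  pushforward leb (fun t : measurableTypeR R => (t - a)%R : measurableTypeR R) B
    = leb B.
Proof.
move=> mB.
have mf : measurable_fun setT (fun t : measurableTypeR R => (t - a)%R : measurableTypeR R).
  exact: measurable_funB.
apply/esym/(@lebesgue_measure_unique _ (pushm leb mf)) => //= _ [[b c]] _ <-.
rewrite /pushforward/= (_ : _ @^-1` _ = `](b + a)%R, (c + a)%R]%classic).
  rewrite /leb !lebesgue_measure_itv/= !lte_fin ltrD2r.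
  by case: ifP => // _; rewrite -!EFinB; congr (_%:E); rewrite opprD addrACA subrr addr0.
by apply/seteqP; split => x /=; rewrite !in_itv/= ltrBrDr lerBlDr.
Qed.

(** Serves to bring the interval between two jumps back to the origin, with a = T_n and b =
    S_{n+1}. *)
Lemma ge0_integral_translation (a b : R) (f : R -> \bar R) :
  measurable_fun (`[0%R, b[%classic : set R) f -> (forall t, (0 <= t < b)%R -> 0 <= f t) ->
  \int[leb]_(t in `[a, (a + b)%R[) f (t - a)%R = \int[leb]_(t in `[0%R, b[) f t.
Proof.
move=> mf f0.
have mg : measurable_fun setT (fun t : measurableTypeR R => (t - a)%R : measurableTypeR R).
  exact: measurable_funB.
set g := (fun t : measurableTypeR R => (t - a)%R) in mg *.
rewrite (_ : `[a, _[%classic = g @^-1` `[0%R, b[); last first.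
  by apply/seteqP; split => x /=; rewrite !in_itv/= lerBrDr ltrBlDr add0r (addrC a).
transitivity (\int[pushm leb mg]_(t in (`[0%R, b[%classic : set (measurableTypeR R))) f t); last first.
  by apply: eq_setfun_integral => B mB; exact: lebesgue_measure_translation.
rewrite (ge0_integral_pushforward mg leb _ mf)//.
by move=> t; rewrite inE /= in_itv/=; exact: f0.
Qed.

End translation.

(** * The exponential formula for a bounded measurable rate *)

(* d/dt of 1 - exp (- L t) is only an almost everywhere statement for measurable rates;
   instead, the defect on [s, t] is O((t - s)^2), and summing over a partition gives equality. *)
Section intensity.
Context {R : realType}.
Variables (l L : R -> R) (hi : R).
Hypothesis ml : measurable_fun setT (l : measurableTypeR R -> R).
Hypothesis l_bounds : forall u, 0 <= l u <= hi.
Hypothesis mL : measurable_fun setT (L : measurableTypeR R -> R).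
Hypothesis LE : forall t, L t = (\int[leb]_(u in [set u : R | (0 <= u <= t)%R]) l u)%R.

Local Notation I f s t := (\int[leb]_(u in `]s, t]) f u)%R.

Lemma bounded_integrable (f : R -> R) (K s t : R) :
  measurable_fun setT (f : measurableTypeR R -> R) -> (forall u, `|f u| <= K) ->
  leb.-integrable `[s, t] (EFin \o f).
Proof.
move=> mf fK; apply: measurable_bounded_integrable => //.
- by rewrite /leb /= lebesgue_measure_itv/=; case: ifP => _; rewrite ltry.
- exact: measurable_funS mf.
- exists K; split; first exact: num_real.
  by move=> x Kx y _ /=; exact: le_trans (fK y) (ltW Kx).
Qed.

Let hi_ge0 : 0 <= hi.
Proof. by have /andP[] := l_bounds 0; exact: le_trans. Qed.

Let l_abs u : `|l u| <= hi.
Proof. by have /andP[l0 lh] := l_bounds u; rewrite ger0_norm. Qed.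

Lemma cumulativeB s t : 0 <= s -> s <= t -> L t - L s = I l s t.
Proof.
move=> s0 st; rewrite !LE -!set_itvcc.
rewrite Rintegral_itvB ?bnd_simp//.
exact: (bounded_integrable _ _ ml l_abs).
Qed.

Let int_oc (f : R -> R) (s t : R) : (leb
    : {measure set (measurableTypeR R) -> \bar R}).-integrable `[s, t] (EFin \o f) ->
  (leb : {measure set (measurableTypeR R) -> \bar R}).-integrable `]s, t] (EFin \o f).
Proof.
apply: integrableS => //.
by move=> x /=; rewrite !in_itv/= => /andP[/ltW -> ->].
Qed.

Lemma cumulative_bounds s t : 0 <= s -> s <= t ->
  0 <= L t - L s <= hi * (t - s).
Proof.
move=> s0 st; rewrite cumulativeB//; apply/andP; split.
  by apply: Rintegral_ge0 => u _; have /andP[] := l_bounds u.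
have -> : hi * (t - s) = (\int[leb]_(u in `]s, t]) hi)%R.
  rewrite Rintegral_cst// /leb /= lebesgue_measure_itv/= lte_fin.
  case: ltP => //= st'; rewrite -?EFinB//=.
  have -> : s = t by apply/eqP; rewrite eq_le st st'.
  by rewrite subrr mulr0.
apply: le_Rintegral => //.
- exact/int_oc/(bounded_integrable _ _ ml l_abs).
- apply/int_oc/(@bounded_integrable _ hi) => [|u]; first exact: measurable_cst.
  by rewrite ger0_norm.
- by move=> u _; have /andP[] := l_bounds u.
Qed.

Lemma cumulative0 : L 0 = 0.
Proof.
rewrite LE -set_itvcc set_itv1.
by rewrite Rintegral_set1.
Qed.

Lemma cumulative_ge0 t : 0 <= t -> 0 <= L t.
Proof. by move=> t0; have := cumulative_bounds (lexx 0) t0; rewrite cumulative0 subr0 => /andP[]. Qed.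

Let e u := expR (- L u) * l u.

(** At negative times the domain of integration is empty. Hence [L] is nonnegative and [e] bounded
    on the whole line, as [bounded_integrable] requires. *)
Let Lneg u : u <= 0 -> L u = 0.
Proof.
rewrite le_eqVlt => /predU1P[->|u0]; first exact: cumulative0.
rewrite LE (_ : [set _ | _] = set0) ?Rintegral_set0// -subset0 => v /=.
by move=> /andP[v0 /(le_trans v0)]; rewrite leNgt u0.
Qed.

Let me : measurable_fun setT (e : measurableTypeR R -> R).
Proof.
apply: measurable_funM => //; apply: measurableT_comp; first exact: measurable_expR.
exact: measurableT_comp.
Qed.

Let L_ge0 u : 0 <= L u.
Proof. by have [u0|/ltW u0] := leP u 0; [rewrite Lneg|exact: cumulative_ge0]. Qed.

Let e_abs u : `|e u| <= hi.
Proof.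
have /andP[l0 lh] := l_bounds u.
rewrite ger0_norm ?mulr_ge0 ?expR_ge0// -[leRHS]mul1r ler_pM ?expR_ge0//.
by rewrite -expR0 ler_expR oppr_le0.
Qed.

Let int_lZ (k s t : R) :
  (leb : {measure set (measurableTypeR R) -> \bar R}).-integrable `]s, t]
    (EFin \o (fun u => k * l u)).
Proof.
apply/int_oc/(@bounded_integrable _ (`|k| * hi)) => [|u].
  exact: measurable_funM.
by rewrite normrM ler_wpM2l.
Qed.

(** With D = L t - L s, both the integral of [e] and the increment e^{-L s} - e^{-L t} lie between
    e^{-L t} D and e^{-L s} D: the former because e^{-L} is nonincreasing, the latter by 1 + x <=
    e^x for x = D and x = -D. They differ by at most (e^{-L s} - e^{-L t}) D <= D^2. *)
Let step s t : 0 <= s -> s <= t ->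
  `|I e s t - (expR (- L s) - expR (- L t))| <= hi ^+ 2 * (t - s) ^+ 2.
Proof.
move=> s0 st; have /andP[D0 Dhi] := cumulative_bounds s0 st.
have mono u : s <= u -> u <= t -> expR (- L t) <= expR (- L u) <= expR (- L s).
  move=> su ut; rewrite !ler_expR !lerN2.
  have /andP[ut0 _] := cumulative_bounds (le_trans s0 su) ut.
  have /andP[su0 _] := cumulative_bounds s0 su.
  by apply/andP; split; rewrite -subr_ge0.
have intl := int_oc (bounded_integrable s t ml l_abs).
have inte := int_oc (bounded_integrable s t me e_abs).
have Ilo : expR (- L t) * (L t - L s) <= I e s t.
  rewrite cumulativeB// -RintegralZl//; apply: le_Rintegral => //.
  move=> u /=; rewrite in_itv/= => /andP[su ut].
  have /andP[l0 _] := l_bounds u.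
  by rewrite ler_wpM2r//; have /andP[] := mono _ (ltW su) ut.
have Ihi : I e s t <= expR (- L s) * (L t - L s).
  rewrite cumulativeB// -RintegralZl//; apply: le_Rintegral => //.
  move=> u /=; rewrite in_itv/= => /andP[su ut].
  have /andP[l0 _] := l_bounds u.
  by rewrite ler_wpM2r//; have /andP[] := mono _ (ltW su) ut.
have /andP[est _] := mono _ st (lexx _).
have e1 : expR (- L s) <= 1 by rewrite -expR0 ler_expR oppr_le0.
set D := L t - L s in D0 Dhi Ilo Ihi *.
have et : expR (- L t) = expR (- L s) * expR (- D).
  by rewrite -expRD; congr expR; rewrite /D; ring.
have es : expR (- L s) = expR (- L t) * expR D.
  by rewrite -expRD; congr expR; rewrite /D; ring.
have h1 : expR (- L s) * (1 - D) <= expR (- L t).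
  by rewrite et ler_wpM2l ?expR_ge0// expR_ge1Dx.
have h2 : expR (- L t) * (1 + D) <= expR (- L s).
  by rewrite es ler_wpM2l ?expR_ge0// expR_ge1Dx.
have D2 : D ^+ 2 <= hi ^+ 2 * (t - s) ^+ 2 by rewrite -exprMn lerXn2r ?nnegrE// (le_trans D0).
have d1 : (expR (- L s) - expR (- L t)) * D <= D ^+ 2.
  rewrite expr2 ler_wpM2r//.
  apply: (@le_trans _ _ (expR (- L s) * D)); first lra.
  by rewrite -[leRHS]mul1r ler_wpM2r.
apply: (le_trans _ D2); apply: (le_trans _ d1).
by rewrite ler_norml; apply/andP; split; lra.
Qed.

Let split_e s t : 0 <= s -> s <= t -> I e 0 t = I e 0 s + I e s t.
Proof.
move=> s0 st.
have := @Rintegral_itvB _ e (BRight 0) (BRight t) s.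
rewrite !bnd_simp => /(_ (int_oc (bounded_integrable 0 t me e_abs)) s0 st) <-.
by rewrite addrC subrK.
Qed.

(** The increments of e^{-L} telescope over k steps of length t / (n+1), so the errors of [step]
    just add up. *)
Let partition t n k : 0 <= t ->
  `|I e 0 (k%:R * (t / n.+1%:R)) - (1 - expR (- L (k%:R * (t / n.+1%:R))))|
    <= k%:R * (hi ^+ 2 * (t / n.+1%:R) ^+ 2).
Proof.
move=> t0; set h := t / n.+1%:R.
have h0 : 0 <= h by rewrite divr_ge0.
elim: k => [|k ih].
  rewrite !mul0r cumulative0 oppr0 expR0 subrr subr0.
  by rewrite set_itvoc0 ?Rintegral_set0 ?normr0//; rewrite bnd_simp.
have k0 : 0 <= k%:R * h by rewrite mulr_ge0.
have kS : k%:R * h <= k.+1%:R * h by rewrite ler_wpM2r// ler_nat.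
rewrite (split_e k0 kS); have := step k0 kS.
have -> : k.+1%:R * h - k%:R * h = h by rewrite -natr1; ring.
rewrite -[k.+1%:R]natr1 => st.
rewrite [leRHS]mulrDl mul1r.
set a := I e 0 _ in ih *; set b := I e _ _ in st *.
set x := expR _ in ih st *; set y := expR _ in st *.
have -> : a + b - (1 - y) = (a - (1 - x)) + (b - (x - y)) by ring.
exact: le_trans (ler_normD _ _) (lerD ih st).
Qed.

Lemma Rintegral_expR_cumulative t : 0 <= t ->
  (\int[leb]_(u in `[0%R, t]) (expR (- L u) * l u))%R = 1 - expR (- L t).
Proof.
move=> t0; rewrite -Rintegral_itv_obnd_cbnd; last first.
  exact: (int_oc (bounded_integrable 0 t me e_abs)).
apply/eqP; rewrite -subr_eq0 -normr_le0; apply/ler_addgt0Pl => eps eps0.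
(* After all n+1 steps the accumulated error is hi^2 t^2 / (n+1), which this n brings below eps. *)
rewrite addr0; pose n := Num.truncn (hi ^+ 2 * t ^+ 2 / eps).
have nE : n.+1%:R * (t / n.+1%:R) = t by field.
have := partition n n.+1 t0; rewrite nE => /le_trans; apply.
have -> : n.+1%:R * (hi ^+ 2 * (t / n.+1%:R) ^+ 2) = hi ^+ 2 * t ^+ 2 / n.+1%:R.
  by field.
rewrite ler_pdivrMr ?ltr0n// [leRHS]mulrC -ler_pdivrMr//.
exact/ltW/truncnS_gt.
Qed.

End intensity.

(** * Borel sets of topological spaces and of products with R^d *)

Section borel_measurability.
Context {R : realType}.

Lemma open_borel_measurable (T : ptopologicalType) (U : set T) :
  open U -> measurable (U : set (borel T)).
Proof. by move=> oU; exact: sub_sigma_algebra. Qed.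

Lemma continuous_real_measurable (S : ptopologicalType) (f : S -> R) :
  continuous f -> measurable_fun setT (f : borel S -> measurableTypeR R).
Proof.
move=> /continuousP cf.
apply: (@measurability _ _ (borel S) (measurableTypeR R) setT f _ (RGenOInfty.measurableE R))
    => // _ [_ [x ->] <-].
rewrite setTI; apply: open_borel_measurable; apply: cf.
exact: interval_open.
Qed.

Let rat_point d (p : 'rV[rat]_d) : 'rV[R]_d := map_mx ratr p.

Let rat_dense d (y : 'rV[R]_d) (e : R) : 0 < e ->
  exists p : 'rV[rat]_d, ball y e (rat_point p).
Proof.
move=> e0.
have /= coord j : exists q : rat, ball (y ord0 j) e (ratr q).
  have [q qy] : exists q : rat, ratr q \in `]y ord0 j - e, y ord0 j + e[.
    by have [|q qy] := @rat_in_itvoo R (y ord0 j - e) (y ord0 j + e);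
      [lra | exists q].
  exists q; rewrite /ball/= distrC ltr_norml.
  by move: qy; rewrite in_itv/= => /andP[? ?]; apply/andP; split; lra.
exists (\row_j projT1 (cid (coord j))).
split => // i j; rewrite !mxE ord1.
by case: cid => q /= qb; exact: qb.
Qed.

(* Countably many rational balls suffice to write an open subset of the product
   as a union of open rectangles; the second factor is arbitrary. *)
Lemma open_prod_measurable d (T : ptopologicalType) (U : set ('rV[R]_d * T)) :
  open U -> measurable (U : set (state R d * borel T)).
Proof.
move=> oU.
pose B (i : 'rV[rat]_d * nat) : set 'rV[R]_d := ball (rat_point i.1) i.2.+1%:R^-1.
pose V i : set T := \bigcup_(W in [set W | open W /\ B i `*` W `<=` U]) W.
rewrite (_ : U = \bigcup_i (B i `*` V i)).
  apply: countable_bigcupT_measurable => [|i]; first exact: countableP.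
  apply: measurableX; apply: open_borel_measurable; first exact: ball_open.
  by apply: bigcup_open => W [].
apply/seteqP; split => [[y a] Uya|[y a] [i _ [/= By [W [oW BWU] Wa]]]]; last exact: BWU.
have [[Y W] /= [nY nW] YWU] : nbhs (y, a) U by exact: open_nbhs_nbhs.
move: nY => /nbhs_ballP[e /= e0 yeY].
(* Two radii 1/(k+1) fit into e: the rational centre is within one radius of y, and the points of
   its ball are within another. *)
pose k := Num.truncn (2 / e).
have ke : k.+1%:R^-1 + k.+1%:R^-1 <= e.
  have : 2 / e < k.+1%:R by exact: truncnS_gt.
  rewrite ltr_pdivrMr// => ke.
  have k0 : 0 < k.+1%:R :> R by rewrite ltr0n.
  have -> : k.+1%:R^-1 + k.+1%:R^-1 = 2 / k.+1%:R :> R by field.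
  by rewrite ler_pdivrMr// mulrC ltW.
have k0 : 0 < k.+1%:R^-1 :> R by rewrite invr_gt0.
have [p yp] := rat_dense y k0.
exists (p, k) => //; split => /=; first exact: ball_sym.
exists W^° => /=; last by rewrite /interior.
split; first exact: open_interior.
move=> [z b] [/= Bz /interior_subset Wb].
apply: YWU; split => //=; apply: yeY; apply: le_ball ke _ _.
exact: ball_triangle yp Bz.
Qed.

End borel_measurability.

Section product_measurability.
Context {R : realType} (d : nat).

Lemma continuous_prod_measurable (S T : ptopologicalType) (f : 'rV[R]_d * T -> S) :
  continuous f -> measurable_fun setT (f : state R d * borel T -> borel S).
Proof.
move=> /continuousP cf.
apply: (@measurability _ _ _ (borel S) setT _ (@open S)) => // _ [U oU <-].
by rewrite setTI; apply: open_prod_measurable; exact: cf.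
Qed.

Lemma continuous_prod_real_measurable (T : ptopologicalType) (f : 'rV[R]_d * T -> R) :
  continuous f -> measurable_fun setT (f : state R d * borel T -> measurableTypeR R).
Proof.
move=> /continuousP cf.
apply: (@measurability _ _ _ (measurableTypeR R) setT _ _ (RGenOInfty.measurableE R)) => // _
    [_ [x ->] <-].
rewrite setTI; apply: open_prod_measurable; apply: cf.
exact: interval_open.
Qed.

(** Addition enters because an observation is the post-jump state plus a noise of law [Qeps]. *)
Lemma measurable_state_add :
  measurable_fun setT (fun z : state R d * state R d => (z.1 + z.2 : 'rV[R]_d) : state R d).
Proof.
apply: (@continuous_prod_measurable 'rV[R]_d 'rV[R]_d (fun z => z.1 + z.2)).
exact: add_continuous.
Qed.

End product_measurability.

(** * Measurability of mu |-> mu(C) for the Borel sets of the weak topology *)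

Section probability_evaluation.
Context {R : realType} (A : pmetricType R).
Implicit Types (mu : probA A) (U : set A).

Let measurable_weak_eval (f : bcont A) :
  measurable_fun setT (fun mu : probA A => weak_eval mu f : measurableTypeR R).
Proof.
apply: continuous_real_measurable.
have pc : continuous (fun g : {ptws bcont A -> R} => (g f : R)).
  exact: (@proj_continuous (bcont A) (fun=> R : topologicalType) f).
apply/continuousP => V oV; exists ((fun g : {ptws bcont A -> R} => (g f : R)) @^-1` V) => //.
by move/continuousP : pc; exact.
Qed.

(* For open U, the bounded continuous functions 1 - exp (- k d(a, ~U)) increase to the
   indicator of U. *)
Let dist_to (U : set A) (a : A) : R := inf [set mdist a b | b in ~` U].

Let has_inf_dist U a : ~` U !=set0 -> has_inf [set mdist a b | b in ~` U].
Proof.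
move=> [b Ub]; split; first by exists (mdist a b); exists b.
by exists 0 => _ [c _ <-]; exact: mdist_ge0.
Qed.

Let dist_to_ge0 U a : 0 <= dist_to U a.
Proof.
have [U0|/set0P U0] := eqVneq (~` U) set0.
  by rewrite /dist_to U0 image_set0 inf0.
apply: lb_le_inf; first by have [] := has_inf_dist a U0.
by move=> _ [c _ <-]; exact: mdist_ge0.
Qed.

Let dist_to_le U a b : (~` U) b -> dist_to U a <= mdist a b.
Proof.
move=> Ub; apply: ge_inf; last by exists b.
by exists 0 => _ [c _ <-]; exact: mdist_ge0.
Qed.

Let dist_to_lip U a a' : ~` U !=set0 -> dist_to U a <= mdist a a' + dist_to U a'.
Proof.
move=> U0; rewrite -lerBlDl; apply: lb_le_inf.
  by have [] := has_inf_dist a' U0.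
move=> _ [b Ub <-]; rewrite lerBlDl.
by apply: le_trans (metric_triangle a a' b); exact: dist_to_le.
Qed.

Let dist_to_continuous U : ~` U !=set0 -> continuous (dist_to U).
Proof.
move=> U0 a; apply/cvgrPdist_lt => e e0.
apply/nbhs_ballP; exists e => //= a'; rewrite ballEmdist /= => aa'.
apply: le_lt_trans aa'; rewrite ler_norml; apply/andP; split.
  by have := dist_to_lip a' a U0; rewrite metric_sym; lra.
by have := dist_to_lip a a' U0; lra.
Qed.

Let dist_to_gt0 U a : ~` U !=set0 -> open U -> U a -> 0 < dist_to U a.
Proof.
move=> U0 oU Ua.
have /nbhs_ballP[e /= e0 aeU] : nbhs a U by exact: open_nbhs_nbhs.
apply: (lt_le_trans e0); apply: lb_le_inf; first by have [] := has_inf_dist a U0.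
move=> _ [b Ub <-]; rewrite leNgt; apply/negP => abe; apply: Ub; apply: aeU.
by rewrite ballEmdist.
Qed.

Let bump U (k : nat) (a : A) : R := 1 - expR (- (k%:R * dist_to U a)).

Let bump_bounds U k a : 0 <= bump U k a <= 1.
Proof.
rewrite /bump subr_ge0 lerBlDr lerDl expR_ge0 andbT.
by rewrite -expR0 ler_expR oppr_le0 mulr_ge0.
Qed.

Let bump_continuous U (k : nat) : ~` U !=set0 -> continuous (bump U k).
Proof.
move=> U0 a; apply: cvgB; first exact: cvg_cst.
apply: (@continuous_comp _ _ _ (fun a => - (k%:R * dist_to U a)) expR); last exact: continuous_expR.
by apply: cvgN; apply: cvgM; [exact: cvg_cst|exact: dist_to_continuous].
Qed.

Let measurable_probA_open U : open U ->
  measurable_fun setT (fun mu : probA A => (mu : probability (borel A) R) U).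
Proof.
(* For U the whole space there is no complement to keep away from: the infimum of the empty set is 0
   and the bumps would vanish. This case is settled by mu(A) = 1. *)
move=> oU; have [U0|] := pselect (~` U !=set0); last first.
  move=> /set0P/negP/negPn/eqP U0.
  have {U0 oU}-> : U = setT by rewrite -[LHS]setCK U0 setC0.
  have -> : (fun mu : probA A => (mu : probability (borel A) R) setT) = cst 1%E.
    by apply/funext => mu; rewrite probability_setT.
  exact: measurable_cst.
have bumpP k : exists K : R, forall a, `|bump U k a| <= K.
  by exists 1 => a; have /andP[b0 b1] := bump_bounds U k a; rewrite ger0_norm.
pose f k : bcont A := BCont (bump_continuous (k := k) U0) (bumpP k).
apply: (@emeasurable_fun_cvg _ _ _ _ (fun k (mu : probA A) => (weak_eval mu (f k))%:E)).
  by move=> k; apply/measurable_EFinP; exact: measurable_weak_eval.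
move=> mu _ /=.
have mbump k : measurable_fun setT (bump U k : borel A -> measurableTypeR R).
  by apply: continuous_real_measurable; exact: bump_continuous.
have mEb k : measurable_fun setT (fun a : borel A => (bump U k a)%:E).
  exact: (measurableT_comp (@EFin_measurable R setT) (mbump k)).
have E k : (weak_eval mu (f k))%:E = (\int[mu : probability (borel A) R]_a (bump U k a)%:E)%E.
  rewrite /weak_eval /Rintegral/= fineK// ge0_fin_numE; last first.
    by apply: integral_ge0 => a _; rewrite lee_fin; have /andP[] := bump_bounds U k a.
  apply: (@le_lt_trans _ _ (\int[mu : probability (borel A) R]_a (cst 1 a)%E)%E).
    apply: ge0_le_integral => //.
    - by move=> a _; rewrite lee_fin; have /andP[] := bump_bounds U k a.
    - by move=> a _; rewrite lee_fin; have /andP[] := bump_bounds U k a.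
  rewrite integral_cst// mul1e.
  exact: le_lt_trans (@probability_le1 _ _ _ (mu : probability (borel A) R) _ measurableT) (ltry 1).
under eq_fun do rewrite E.
have -> : (mu : probability (borel A) R) U =
    (\int[mu : probability (borel A) R]_a limn (fun k => (bump U k a)%:E))%E.
  transitivity (\int[mu : probability (borel A) R]_a (\1_U a)%:E)%E.
    rewrite integral_indic//; last exact: open_borel_measurable.
    by rewrite setIT.
  apply: eq_integral => a _; apply/esym/cvg_lim => //.
  apply/fine_cvgP; split; first exact: nearW.
  rewrite /comp /=.
  rewrite indicE; have [/set_mem Ua|/negP aU] := boolP (a \in U); last first.
    have Ua : (~` U) a by move=> Ua; apply: aU; exact: mem_set.
    have d0 : dist_to U a = 0.
      by apply/eqP; rewrite eq_le dist_to_ge0 andbT -(mdistxx a); exact: dist_to_le.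
    rewrite [X in X @ _ --> _](_ : _ = cst 0); first exact: cvg_cst.
    by apply/funext => k; rewrite /bump /= d0 mulr0 oppr0 expR0 subrr.
  rewrite -[X in _ --> X]subr0; apply: cvgB; first exact: cvg_cst.
  apply: (@cvg_comp _ _ _ (fun k : nat => k%:R * dist_to U a) (fun x => expR (- x)) _ +oo%R);
    last exact: cvgr_expR.
  apply/cvgryPge => K; near=> k; rewrite -ler_pdivrMr; last exact: dist_to_gt0.
  by near: k; exact: nbhs_infty_ger.
apply: cvg_monotone_convergence => //.
- by move=> k a _; rewrite lee_fin; have /andP[] := bump_bounds U k a.
- move=> a _ k m km; rewrite lee_fin /bump lerD2l lerN2 ler_expR lerN2.
  by rewrite ler_wpM2r// ler_nat.
Unshelve. all: by end_near. Qed.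

(** Open sets form a generating pi-system, and sets with measurable evaluation are stable under
    complements and disjoint countable unions, all masses being finite. *)
Lemma measurable_probA_eval (C : set (borel A)) : measurable C ->
  measurable_fun setT (fun mu : probA A => (mu : probability (borel A) R) C).
Proof.
move: C; apply: (@dynkin_induction _ (borel A) (@open A)
  (fun C => measurable_fun setT (fun mu : probA A => (mu : probability (borel A) R) C))).
- by [].
- by move=> U V oU oV; exact: openI.
- exact: measurable_probA_open openT.
- by move=> U oU; exact: measurable_probA_open.
- move=> C mC mmC.
  have -> : (fun mu : probA A => (mu : probability (borel A) R) (~` C)) =
      (fun mu : probA A => 1 - (mu : probability (borel A) R) C)%E.
    by apply/funext => mu; rewrite probability_setC.
  exact: emeasurable_funB.
- move=> F mF tF mmF.
  have -> : (fun mu : probA A => (mu : probability (borel A) R) (\bigcup_k F k)) =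
      (fun mu : probA A => \sum_(0 <= k <oo) (mu : probability (borel A) R) (F k))%E.
    apply/funext => mu; apply/esym/cvg_lim => //.
    apply: (@measure_semi_sigma_additive _ _ _ (mu : probability (borel A) R) F mF tF).
    exact: bigcupT_measurable.
  exact: ge0_emeasurable_sum.
Qed.

End probability_evaluation.

(** * Measurable maps into P(A) as probability kernels *)

Section probA_kernel.
Context {R : realType} (A : pmetricType R) dX (X : measurableType dX).
Variables (rho : X -> probA A) (mrho : measurable_fun setT rho).

Definition kprobA of measurable_fun setT rho : X -> {measure set (borel A) -> \bar R} :=
  fun x => (rho x : probability (borel A) R).

Let measurable_kprobA U : measurable U -> measurable_fun setT (kprobA mrho ^~ U).
Proof. by move=> mU; exact: measurableT_comp (measurable_probA_eval mU) mrho. Qed.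

HB.instance Definition _ := isKernel.Build _ _ X (borel A) R (kprobA mrho) measurable_kprobA.

Let kprobA_prob x : kprobA mrho x setT = 1%E.
Proof. exact: (@probability_setT _ _ _ (rho x : probability (borel A) R)). Qed.

HB.instance Definition _ := Kernel_isProbability.Build _ _ X (borel A) R (kprobA mrho) kprobA_prob.

Lemma measurable_integral_probA (f : X * borel A -> \bar R) :
  (forall z, (0 <= f z)%E) -> measurable_fun setT f ->
  measurable_fun setT (fun x => \int[rho x : probability (borel A) R]_a f (x, a))%E.
Proof. by move=> f0 mf; exact: (measurable_fun_integral_finite_kernel f (kprobA mrho)). Qed.

End probA_kernel.

(** * One stage between two jumps: rate, cumulative hazard and transition kernel *)

Section stage.
Context {R : realType} {d : nat} {A : pmetricType R} (M : pdmdp d A).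
Local Notation E := (state R d).
Local Notation time := (measurableTypeR R).
Variables (lo hi : R) (lo_gt0 : 0 < lo)
  (lam_bounds : forall ya : 'rV[R]_d * A, lo <= lamA M ya <= hi).
Context dW (W : measurableType dW).
Variables (phi : W * time -> E) (rho : W * time -> probA A).
Hypothesis mphi : measurable_fun setT phi.
Hypothesis mrho : measurable_fun setT rho.

Let prob (z : W * time) : probability (borel A) R := rho z.

Let mlam : measurable_fun setT (lamA M : E * borel A -> measurableTypeR R).
Proof. exact: continuous_prod_real_measurable (@lamA_continuous _ _ _ M). Qed.

Let mlamphi : measurable_fun setT (fun z : (W * time) * borel A => lamA M (phi z.1, z.2)).
Proof.
apply: (measurableT_comp mlam); apply: measurable_fun_pair.
  exact: (measurableT_comp mphi measurable_fst).
exact: measurable_snd.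
Qed.

Let mlamz z : measurable_fun setT (fun a : borel A => (lamA M (phi z, a))%:E).
Proof.
exact: (measurableT_comp (@EFin_measurable R setT) (measurableT_comp mlamphi (pair1_measurable z))).
Qed.

Let int_cst z (c : R) : (\int[prob z]_a (cst c%:E a))%E = c%:E.
Proof.
rewrite integral_cst//; transitivity (c%:E * 1)%E; last by rewrite mule1.
by congr (_ * _)%E; exact: probability_setT.
Qed.

Let lam_ge0 ya : 0 <= lamA M ya.
Proof. by have /andP[+ _] := lam_bounds ya; apply: le_trans; exact: ltW. Qed.

Definition rate (z : W * time) : R := (\int[prob z]_a lamA M (phi z, a))%R.

Lemma rateE z : (rate z)%:E = (\int[prob z]_a (lamA M (phi z, a))%:E)%E.
Proof.
rewrite /rate /Rintegral fineK// ge0_fin_numE; last first.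
  by apply: integral_ge0 => a _; rewrite lee_fin lam_ge0.
apply: (@le_lt_trans _ _ (\int[prob z]_a (cst hi%:E a))%E).
  have mz := mlamz z.
  apply: ge0_le_integral => //.
  - by move=> a _; rewrite lee_fin lam_ge0.
  - by move=> a _; rewrite lee_fin; have /andP[] := lam_bounds (phi z, a).
by rewrite int_cst ltry.
Qed.

Lemma rate_bounds z : lo <= rate z <= hi.
Proof.
have mz := mlamz z.
rewrite -!lee_fin rateE -(int_cst z lo) -(int_cst z hi); apply/andP; split.
  apply: ge0_le_integral => //.
  - by move=> a _ /=; rewrite lee_fin ltW.
  - by move=> a _; rewrite lee_fin; have /andP[] := lam_bounds (phi z, a).
apply: ge0_le_integral => //.
- by move=> a _; rewrite lee_fin lam_ge0.
- by move=> a _; rewrite lee_fin; have /andP[] := lam_bounds (phi z, a).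
Qed.

Lemma rate_ge0 z : 0 <= rate z.
Proof. by have /andP[+ _] := rate_bounds z; apply: le_trans; exact: ltW. Qed.

Lemma measurable_rate : measurable_fun setT (rate : W * time -> measurableTypeR R).
Proof.
apply/measurable_EFinP; rewrite (_ : _ \o _ =
  fun z => (\int[prob z]_a (lamA M (phi z, a))%:E)%E); last first.
  by apply/funext => z /=; rewrite rateE.
apply: (measurable_integral_probA mrho (f := fun z => (lamA M (phi z.1, z.2))%:E)).
  by move=> z; rewrite lee_fin lam_ge0.
exact/measurable_EFinP.
Qed.

(** The exponent [Lambda] along an abstract flow [phi] and control [rho]. Their joint measurability
    in parameter and time makes it measurable in both. *)
Definition hazard (z : W * time) : R :=
  (\int[leb]_(u in [set u : R | (0 <= u <= z.2)%R]) rate (z.1, u))%R.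

Lemma measurable_itv_0t t : measurable ([set u | 0 <= u <= t] : set time).
Proof. by rewrite -set_itvcc; exact: measurable_itv. Qed.

Lemma hazardE z : (hazard z)%:E =
  (\int[leb]_(u in [set u : R | (0 <= u <= z.2)%R]) (rate (z.1, u))%:E)%E.
Proof.
rewrite /hazard /Rintegral fineK// ge0_fin_numE; last first.
  by apply: integral_ge0 => u _; rewrite lee_fin rate_ge0.
apply: (@le_lt_trans _ _ (\int[leb]_(u in [set u : R | (0 <= u <= z.2)%R]) (cst hi%:E u))%E).
  apply: ge0_le_integral => //.
  - exact: measurable_itv_0t.
  - by move=> u _; rewrite lee_fin rate_ge0.
  - apply/measurable_EFinP/measurable_funTS.
    exact: (measurableT_comp measurable_rate (pair1_measurable z.1)).
  - by move=> u _; rewrite lee_fin; have /andP[] := rate_bounds (z.1, u).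
rewrite integral_cst//; last exact: measurable_itv_0t.
rewrite -set_itvcc /leb /= lebesgue_measure_itv/=.
by case: ifP => _; rewrite ?mule0 -?EFinM ltry.
Qed.

(** The domain of integration moves with the point; once it is an indicator inside the integrand,
    Tonelli's theorem gives measurability. *)
Lemma measurable_hazard : measurable_fun setT (hazard : W * time -> measurableTypeR R).
Proof.
pose f (z : (W * time) * time) : \bar R :=
  ((rate (z.1.1, z.2))%:E * (\1_[set z : (W * time) * time | 0 <= z.2 <= z.1.2] z)%:E)%E.
have mf : measurable_fun setT f.
  apply: emeasurable_funM; apply/measurable_EFinP.
    apply: (measurableT_comp measurable_rate); apply: measurable_fun_pair.
      exact: (measurableT_comp measurable_fst measurable_fst).
    exact: measurable_snd.
  apply: measurable_indic.
  rewrite (_ : mkset _ = [set z | 0 <= z.2] `&` [set z | z.2 <= z.1.2]); last first.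
    by apply/seteqP; split => z /=; [move/andP|move/andP].
  apply: measurableI.
    by rewrite -[X in measurable X]setTI; exact: measurable_fun_le.
  rewrite -[X in measurable X]setTI; apply: measurable_fun_le => //.
  exact: (measurableT_comp measurable_snd measurable_fst).
have f0 z : (0 <= f z)%E by rewrite /f mule_ge0 ?lee_fin ?rate_ge0.
apply/measurable_EFinP; rewrite (_ : _ \o _ = fun z => (\int[leb]_u f (z, u))%E); last first.
  apply/funext => z /=; rewrite hazardE integral_mkcond; apply: eq_integral => u _.
  rewrite patchE /f /= indicE; case: ifPn => [|] uz.
    by rewrite mem_set ?mule1//; exact: set_mem uz.
  rewrite memNset ?mule0// => uz'; move/negP : uz; apply; exact: mem_set.
exact: (@measurable_fun_fubini_tonelli_F _ _ _ _ _ leb f).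
Qed.

Section stage_kernel.
Variables (b : R) (b_ge0 : 0 <= b).

(* The indicator restricts the first component to u >= 0, so that Lebesgue measure on the
   whole line can be used in [stage_ker]. *)
Definition weight (z : (W * time) * borel A) : R :=
  \1_[set u : R | 0 <= u] z.1.2 * expR (- (b * z.1.2 + hazard z.1)) * lamA M (phi z.1, z.2).

Lemma hazard_ge0 z : 0 <= hazard z.
Proof. by apply: Rintegral_ge0 => u _; exact: rate_ge0. Qed.

Lemma weight_ge0 z : 0 <= weight z.
Proof. by rewrite /weight !mulr_ge0 ?expR_ge0. Qed.

Lemma weight_le z : weight z <= hi.
Proof.
rewrite /weight indicE; have [/set_mem /= u0|_] := boolP (_ \in _); last first.
  by rewrite !mul0r (le_trans (lam_ge0 (phi z.1, z.2)))//; have /andP[] := lam_bounds (phi z.1, z.2).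
rewrite mul1r -[leRHS]mul1r ler_pM ?expR_ge0//; last by have /andP[] := lam_bounds (phi z.1, z.2).
by rewrite -expR0 ler_expR oppr_le0 addr_ge0 ?hazard_ge0// mulr_ge0.
Qed.

Lemma measurable_weight : measurable_fun setT (weight : _ -> measurableTypeR R).
Proof.
have m12 : measurable_fun setT (fun z : (W * time) * borel A => z.1.2).
  exact: (measurableT_comp measurable_snd measurable_fst).
apply: measurable_funM; last exact: mlamphi.
apply: measurable_funM.
  apply: (measurableT_comp _ m12); apply: measurable_indic; exact: measurable_Rge0.
apply: measurableT_comp; first exact: measurable_expR.
apply: measurableT_comp => //; apply: measurable_funD.
  exact: measurable_funM.
exact: (measurableT_comp measurable_hazard measurable_fst).
Qed.

Let weight_nng z : {nonneg R} := NngNum (weight_ge0 z).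

Let mphia : measurable_fun setT (fun z : (W * time) * borel A => (phi z.1, z.2)).
Proof.
apply: measurable_fun_pair; last exact: measurable_snd.
exact: (measurableT_comp mphi measurable_fst).
Qed.

(** The variables are, in order, parameter, jump time, action, post-jump state y' and noise e. The
    measure D |-> [Qeps] (D - y') is the law of e + y'. *)
Let step_fun (z : (((W * time) * borel A) * E) * E) : W * (time * (E * E)) :=
  (z.1.1.1.1, (z.1.1.1.2, (z.1.2, z.2 + z.1.2))).

Let mstep_fun : measurable_fun setT step_fun.
Proof.
have m1 : measurable_fun setT (fun z : (((W * time) * borel A) * E) * E => z.1.1.1).
  apply: (measurableT_comp measurable_fst).
  exact: (measurableT_comp measurable_fst measurable_fst).
have m2 : measurable_fun setT (fun z : (((W * time) * borel A) * E) * E => z.1.2).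
  exact: (measurableT_comp measurable_snd measurable_fst).
apply: measurable_fun_pair; first exact: (measurableT_comp measurable_fst m1).
apply: measurable_fun_pair; first exact: (measurableT_comp measurable_snd m1).
apply: measurable_fun_pair => //.
have m21 : measurable_fun setT (fun z : (((W * time) * borel A) * E) * E => (z.2, z.1.2)).
  by apply: measurable_fun_pair => //; exact: measurable_snd.
exact: (measurableT_comp (@measurable_state_add R d) m21).
Qed.

Let k4 : R.-fker (((W * time) * borel A) * E) ~> E := kconst (Qeps M).
Let k5 : R.-sfker ((((W * time) * borel A) * E) * E) ~> (W * (time * (E * E)))%type :=
  kdirac mstep_fun.
Let k45 : R.-sfker (((W * time) * borel A) * E) ~> (W * (time * (E * E)))%type := mkcomp k4 k5.
Let k3 : R.-fker ((W * time) * borel A) ~> E :=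
  @kscale _ _ _ _ R hi (kprecomp (QA M) mphia) weight_nng measurable_weight weight_le.
Let k345 : R.-sfker ((W * time) * borel A) ~> (W * (time * (E * E)))%type := mkcomp k3 k45.
Let k2 : R.-fker (W * time) ~> borel A := kprobA mrho.
Let k2345 : R.-sfker (W * time) ~> (W * (time * (E * E)))%type := mkcomp k2 k345.
Let k1 : R.-sfker W ~> time := sfkconst leb.

(** The jump time is drawn from Lebesgue measure, the action from [rho], the state from [QA] and the
    noise from [Qeps]; the density of the jump time and the intensity are put into the scaling of
    [QA]. Only the Lebesgue factor is infinite, whence s-finiteness. The parameter is copied to the
    output, so that kernels for successive stages can be chained. *)
Definition stage_ker : R.-sfker W ~> (W * (time * (E * E)))%type := mkcomp k1 k2345.

Local Open Scope ereal_scope.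

Lemma integral_stage_ker (F : W * (time * (E * E)) -> \bar R) w :
  (forall z, 0 <= F z) -> measurable_fun setT F ->
  \int[stage_ker w]_z F z =
  \int[leb]_u \int[prob (w, u)]_a ((weight ((w, u), a))%:E *
    \int[QA M (phi (w, u), a)]_y' \int[Qeps M]_e F (w, (u, (y', (e + y')%R)))).
Proof.
move=> F0 mF; rewrite [LHS]integral_kcomp//.
apply: eq_integral => u _; rewrite [LHS]integral_kcomp//.
apply: eq_integral => a _; rewrite [LHS]integral_kcomp//.
have mstep : measurable_fun setT (F \o step_fun) by exact: measurableT_comp.
have -> : \int[k3 ((w, u), a)]_y \int[k45 ((w, u), a, y)]_z F z =
  \int[k3 ((w, u), a)]_y' \int[Qeps M]_e F (w, (u, (y', (e + y')%R))).
  apply: eq_integral => y' _; rewrite [LHS]integral_kcomp//.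
  apply: eq_integral => e _; rewrite integral_dirac//.
  by rewrite diracT mul1e.
rewrite ge0_integral_mscale//.
- rewrite (_ : (fun y' => _) = (fun y' => \int[k4 ((w, u), a, y')]_e (F \o step_fun) (((w, u),
    a, y'), e)))//.
  have := @measurable_fun_integral_sfinite_kernel _ _ _ _ R (F \o step_fun) k4 (fun z => F0 _) mstep.
  by move=> /measurableT_comp /(_ (pair1_measurable ((w, u), a))).
- by move=> y' _; apply: integral_ge0.
Qed.

Let integral_prob_cst dX (X : measurableType dX) (m : {measure set X -> \bar R}) (c : \bar R) :
  m setT = 1 -> \int[m]_x c = c.
Proof.
move=> m1; transitivity (c * m setT); first exact: integral_cst.
by rewrite m1 mule1.
Qed.

Lemma weightE w u a : (weight ((w, u), a))%:E =
  (\1_[set u : R | (0 <= u)%R] u * expR (- (b * u + hazard (w, u))))%:E *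
  (lamA M (phi (w, u), a))%:E.
Proof. by rewrite -EFinM. Qed.

Lemma ge0_integral_weight w u (f : borel A -> \bar R) : (forall a, 0 <= f a) ->
  measurable_fun setT f ->
  \int[prob (w, u)]_a ((weight ((w, u), a))%:E * f a) =
  (\1_[set u : R | (0 <= u)%R] u * expR (- (b * u + hazard (w, u))))%:E *
    \int[prob (w, u)]_a ((lamA M (phi (w, u), a))%:E * f a).
Proof.
move=> f0 mf; rewrite -ge0_integralZl//.
- by apply: eq_integral => a _; rewrite weightE muleA.
- exact: emeasurable_funM.
- by move=> a _; rewrite mule_ge0// lee_fin lam_ge0.
Qed.

Lemma integral_Rge0 (f : R -> \bar R) :
  \int[leb]_(u in Rge0) f u = \int[leb]_u ((\1_[set u : R | (0 <= u)%R] u)%:E * f u).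
Proof.
rewrite integral_mkcond; apply: eq_integral => u _; rewrite patchE indicE.
by rewrite /Rge0; case: ifPn => _; rewrite ?mul1e ?mul0e.
Qed.

Let measurable_jump_integral (F : W * (time * (E * E)) -> \bar R) w u :
  (forall z, 0 <= F z) -> measurable_fun setT F ->
  measurable_fun setT (fun a : borel A =>
    \int[QA M (phi (w, u), a)]_y' \int[Qeps M]_e F (w, (u, (y', (e + y')%R)))).
Proof.
move=> F0 mF.
have mstep : measurable_fun setT (F \o step_fun) by exact: measurableT_comp.
have m4 := @measurable_fun_integral_sfinite_kernel _ _ _ _ R (F \o step_fun) k4 (fun z => F0 _) mstep.
have i0 z : 0 <= \int[k4 z]_e (F \o step_fun) (z, e).
  by apply: integral_ge0 => e _; exact: F0.
have m3 := @measurable_fun_integral_sfinite_kernel _ _ _ _ R _ (kprecomp (QA M) mphia) i0 m4.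
exact: (measurableT_comp m3 (pair1_measurable (w, u))).
Qed.

Lemma integral_stage_kerE (F : W * (time * (E * E)) -> \bar R) w :
  (forall z, 0 <= F z) -> measurable_fun setT F ->
  \int[stage_ker w]_z F z =
  \int[leb]_(u in Rge0) ((expR (- (b * u + hazard (w, u))))%:E *
    \int[prob (w, u)]_a ((lamA M (phi (w, u), a))%:E *
      \int[QA M (phi (w, u), a)]_y' \int[Qeps M]_e F (w, (u, (y', (e + y')%R))))).
Proof.
move=> F0 mF; rewrite [LHS]integral_stage_ker// integral_Rge0; apply: eq_integral => u _.
rewrite ge0_integral_weight; first by rewrite EFinM muleA.
  by move=> a; apply: integral_ge0 => y' _; exact: integral_ge0.
exact: measurable_jump_integral.
Qed.

(** State and noise integrate out to 1, and averaging the intensity over actions leaves [rate]. *)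
Lemma integral_stage_ker_time w (f : time -> \bar R) :
  (forall u, 0 <= f u) -> measurable_fun setT f ->
  \int[stage_ker w]_z f z.2.1 =
  \int[leb]_(u in Rge0)
    ((expR (- (b * u + hazard (w, u))) * rate (w, u))%:E * f u).
Proof.
move=> f0 mf.
have mf21 : measurable_fun setT (fun z : W * (time * (E * E)) => f z.2.1).
  apply: (measurableT_comp mf); exact: (measurableT_comp measurable_fst measurable_snd).
rewrite integral_stage_ker// integral_Rge0; apply: eq_integral => u _ /=.
transitivity (\int[prob (w, u)]_a ((weight ((w, u), a))%:E * f u)).
  apply: eq_integral => a _; congr (_ * _).
  rewrite -[RHS](integral_prob_cst _ (prob_kernel (phi (w, u), a) (s := QA M)));
      apply: eq_integral => y' _.
  exact: (integral_prob_cst _ (probability_setT (Qeps M))).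
rewrite (@ge0_integral_weight w u (fun=> f u))// ge0_integralZr//; last by move=> a _;
    rewrite lee_fin lam_ge0.
by rewrite -rateE !EFinM !muleA.
Qed.

End stage_kernel.

Section stage_tail.
Local Open Scope ereal_scope.
Variable w : W.

Let rate_wb u : (0 <= rate (w, u) <= hi)%R.
Proof. by rewrite rate_ge0; have /andP[] := rate_bounds (w, u). Qed.

Let mrate_w : measurable_fun setT (fun u : time => rate (w, u) : time).
Proof. exact: (measurableT_comp measurable_rate (pair1_measurable w)). Qed.

Let mhazard_w : measurable_fun setT (fun u : time => hazard (w, u) : time).
Proof. exact: (measurableT_comp measurable_hazard (pair1_measurable w)). Qed.

Let density u := (expR (- hazard (w, u)) * rate (w, u))%R.

Let mdensity : measurable_fun setT (density : time -> time).
Proof.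
apply: measurable_funM => //; apply: measurableT_comp; first exact: measurable_expR.
exact: measurableT_comp.
Qed.

Let density_ge0 u : (0 <= density u)%R.
Proof. by rewrite mulr_ge0 ?expR_ge0 ?rate_ge0. Qed.

Lemma hazard_ge_lo t : (0 <= t)%R -> (lo * t <= hazard (w, t))%R.
Proof.
move=> t0; rewrite -lee_fin hazardE.
apply: (@le_trans _ _ (\int[leb]_(u in [set u : R | (0 <= u <= t)%R]) (cst lo%:E u))).
  rewrite integral_cst//; last exact: measurable_itv_0t.
  rewrite -set_itvcc /leb /= lebesgue_measure_itv/= lte_fin.
  by case: ltP t0 => // t0 t0'; rewrite -?EFinB ?subr0 ?EFinM//= (_ : t = 0%R) ?mulr0 ?mule0//;
    apply/eqP; rewrite eq_le t0.
apply: ge0_le_integral => //.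
- exact: measurable_itv_0t.
- by move=> u _; rewrite lee_fin ltW.
- by apply/measurable_EFinP/measurable_funTS.
- by move=> u _; rewrite lee_fin; have /andP[] := rate_bounds (w, u).
Qed.

Lemma hazard_le_hi t : (0 <= t)%R -> (hazard (w, t) <= hi * t)%R.
Proof.
move=> t0; have := cumulative_bounds mrate_w rate_wb (fun=> erefl) (lexx 0%R) t0.
rewrite (cumulative0 (l := fun u => rate (w, u)) (fun=> erefl)) !subr0 => /andP[_].
exact.
Qed.

Lemma stage_integral_le t : (0 <= t)%R ->
  \int[leb]_(u in [set u : R | (0 <= u <= t)%R]) (density u)%:E =
  (1 - expR (- hazard (w, t)))%:E.
Proof.
move=> t0.
rewrite -(Rintegral_expR_cumulative mrate_w rate_wb mhazard_w (fun=> erefl) t0).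
rewrite /Rintegral fineK ?set_itvcc//.
have h u : (`|density u| <= hi)%R.
  rewrite ger0_norm// -[leRHS]mul1r ler_pM ?expR_ge0 ?rate_ge0//.
    by rewrite -expR0 ler_expR oppr_le0 hazard_ge0.
  by have /andP[] := rate_bounds (w, u).
rewrite -set_itvcc; apply: integrable_fin_num => //.
exact: (bounded_integrable 0 t mdensity h).
Qed.

End stage_tail.

End stage.

(* Otherwise unification unfolds the nested kernel compositions and diverges. *)
Opaque stage_ker.

Lemma integral_indicT dX (X : measurableType dX) (R : realType)
    (m : {measure set X -> \bar R}) (B : set X) :
  measurable B -> (\int[m]_x (\1_B x)%:E = m B)%E.
Proof. by move=> mB; rewrite integral_indic// setIT. Qed.

(** * Law of the sojourn time under the stage kernel *)

Section stage_consequences.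
Context {R : realType} {d : nat} {A : pmetricType R} (M : pdmdp d A).
Local Notation E := (state R d).
Local Notation time := (measurableTypeR R).
Variables (lo hi : R) (lo_gt0 : 0 < lo)
  (lam_bounds : forall ya : 'rV[R]_d * A, lo <= lamA M ya <= hi).
Context dW (W : measurableType dW).
Variables (phi : W * time -> E) (rho : W * time -> probA A).
Hypothesis mphi : measurable_fun setT phi.
Hypothesis mrho : measurable_fun setT rho.
Local Open Scope ereal_scope.

Local Notation N b0 := (stage_ker lo_gt0 lam_bounds mphi mrho b0).
Local Notation rate := (rate M phi rho).
Local Notation hazard := (hazard M phi rho).
Local Notation le00 := (lexx (0%R : R)).

Let mtime : measurable_fun setT (fun z : W * (time * (E * E)) => z.2.1).
Proof. exact: (measurableT_comp measurable_fst measurable_snd). Qed.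

(** The kernel copies its starting point. Stated as a substitution under the integral because
    singletons of [W] need not be measurable. *)
Lemma integral_stage_ker_fst (b : R) (b0 : (0 <= b)%R) w
    (F : W * (time * (E * E)) -> \bar R) :
  (forall z, 0 <= F z) -> measurable_fun setT F ->
  \int[N b0 w]_z F z = \int[N b0 w]_z F (w, z.2).
Proof.
move=> F0 mF.
have mG : measurable_fun setT (fun z : W * (time * (E * E)) => F (w, z.2)).
  by apply: measurableT_comp => //; exact: measurable_fun_pair.
rewrite [LHS](integral_stage_ker lo_gt0 lam_bounds mphi mrho b0 w F0 mF).
by rewrite [RHS](integral_stage_ker lo_gt0 lam_bounds mphi mrho b0 w (fun z => F0 _) mG).
Qed.

(** The weights for rates b and 0 differ by the factor e^{-b u}, which depends on the jump time only
    and so moves freely through the inner integrals. *)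
Lemma integral_stage_ker_discount (b : R) (b0 : (0 <= b)%R) w
    (F : W * (time * (E * E)) -> \bar R) :
  (forall z, 0 <= F z) -> measurable_fun setT F ->
  \int[N b0 w]_z F z = \int[N le00 w]_z ((expR (- (b * z.2.1)))%:E * F z).
Proof.
move=> F0 mF.
have me : measurable_fun setT (fun z : W * (time * (E * E)) => (expR (- (b * z.2.1)))%:E).
  apply/measurable_EFinP; apply: measurableT_comp; first exact: measurable_expR.
  by apply: measurableT_comp => //; exact: measurable_funM.
have G0 z : 0 <= (expR (- (b * z.2.1)))%:E * F z by rewrite mule_ge0// lee_fin expR_ge0.
have mG := emeasurable_funM me mF.
rewrite [LHS](integral_stage_ker lo_gt0 lam_bounds mphi mrho b0 w F0 mF).
rewrite [RHS](integral_stage_ker lo_gt0 lam_bounds mphi mrho le00 w G0 mG).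
apply: eq_integral => u _; apply: eq_integral => a _.
have m1 (y' : E) : measurable_fun setT (fun e : E => F (w, (u, (y', (e + y')%R)))).
  apply: (measurableT_comp mF); apply: measurable_fun_pair => //.
  apply: measurable_fun_pair => //; apply: measurable_fun_pair => //.
  have mp : measurable_fun setT (fun e : E => (e, y')) by exact: measurable_fun_pair.
  exact: (measurableT_comp (@measurable_state_add R d) mp).
have m2 : measurable_fun setT (fun y' : E => \int[Qeps M]_e F (w, (u, (y', (e + y')%R)))).
  apply: (@measurable_fun_fubini_tonelli_F _ _ _ _ _ (Qeps M)
    (fun z : E * E => F (w, (u, (z.1, (z.2 + z.1)%R))))) => //.
  apply: (measurableT_comp mF); apply: measurable_fun_pair => //.
  apply: measurable_fun_pair => //; apply: measurable_fun_pair => //.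
  have mp : measurable_fun setT (fun z : E * E => (z.2, z.1)) by exact: measurable_fun_pair.
  exact: (measurableT_comp (@measurable_state_add R d) mp).
have e0 : 0 <= (expR (- (b * u)))%:E :> \bar R by rewrite lee_fin expR_ge0.
set c := (expR (- (b * u)))%:E.
transitivity ((weight M phi rho 0 (w, u, a))%:E *
    (c * \int[QA M (phi (w, u), a)]_y' \int[Qeps M]_e F (w, (u, (y', (e + y')%R))))).
  rewrite muleA; congr (_ * _); rewrite /c /weight mul0r add0r -EFinM; congr (_%:E).
  by rewrite opprD expRD /=; ring.
congr (_ * _); rewrite -ge0_integralZl//; last by move=> y' _; exact: integral_ge0.
by apply: eq_integral => y' _; rewrite -ge0_integralZl.
Qed.

Variable w : W.

Let density u := (expR (- hazard (w, u)) * rate (w, u))%R.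

Let density_ge0 u : (0 <= density u)%R.
Proof. by rewrite mulr_ge0 ?expR_ge0//; exact: (rate_ge0 lo_gt0 lam_bounds). Qed.

Let mdensity : measurable_fun setT (density : time -> time).
Proof.
have mr := measurable_rate lo_gt0 lam_bounds mphi mrho.
have mh := measurable_hazard lo_gt0 lam_bounds mphi mrho.
apply: measurable_funM; last exact: (measurableT_comp mr (pair1_measurable w)).
apply: measurableT_comp; first exact: measurable_expR.
apply: measurableT_comp => //; exact: (measurableT_comp mh (pair1_measurable w)).
Qed.

Lemma integral_stage_ker0_time (f : time -> \bar R) :
  (forall u, 0 <= f u) -> measurable_fun setT f ->
  \int[N le00 w]_z f z.2.1 = \int[leb]_(u in Rge0) ((density u)%:E * f u).
Proof.
move=> f0 mf; rewrite [LHS]integral_stage_ker_time//.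
by apply: eq_integral => u _; rewrite mul0r add0r.
Qed.

Let stage_timeE (B : set time) : measurable B ->
  N le00 w [set z | B z.2.1] = \int[leb]_(u in Rge0) ((density u)%:E * (\1_B u)%:E).
Proof.
move=> mB; rewrite -integral_stage_ker0_time//; last first.
  by apply/measurable_EFinP; exact: measurable_indic.
rewrite -[LHS]integral_indicT; last first.
  by rewrite -[X in measurable X]setTI; exact: mtime.
by apply: eq_integral.
Qed.

Lemma stage_ker_le t : (0 <= t)%R ->
  N le00 w [set z | (z.2.1 <= t)%R] = (1 - expR (- hazard (w, t)))%:E.
Proof.
move=> t0; rewrite (stage_timeE (B := [set u | (u <= t)%R])); last first.
  by rewrite -set_itvNyc; exact: measurable_itv.
rewrite -(stage_integral_le lo_gt0 lam_bounds mphi mrho w t0).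
rewrite integral_mkcond [RHS]integral_mkcond; apply: eq_integral => u _.
rewrite !patchE indicE /Rge0; case: ifPn => [/set_mem /= u0|u0].
  have [ut|ut] := boolP (_ \in [set u | (u <= t)%R]).
    by rewrite mule1 ifT//; apply/mem_set; rewrite /= u0; exact: set_mem ut.
  rewrite mule0 ifF//; apply/negbTE; apply: contra ut => /set_mem /= /andP[_ ut].
  exact: mem_set.
rewrite ifF//; apply/negbTE; apply: contra u0 => /set_mem /= /andP[u0 _].
exact: mem_set.
Qed.

(** No mass escapes to infinity: the hazard at time n is at least lo n, so the mass 1 - e^{-hazard}
    of the jumps up to time n tends to 1. *)
Lemma stage_ker_setT : N le00 w setT = 1.
Proof.
pose B n : set (W * (time * (E * E))) := [set z | (z.2.1 <= n%:R)%R].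
have mB n : measurable (B n).
  rewrite -[X in measurable X]setTI.
  exact: (mtime measurableT (measurable_itv `]-oo, n%:R])).
have <- : \bigcup_n B n = setT.
  apply/seteqP; split => // z _; exists (Num.truncn `|z.2.1|).+1 => //.
  rewrite /B /=; apply: (le_trans (ler_norm _)); exact/ltW/truncnS_gt.
have cN : N le00 w (B n) @[n --> \oo] --> N le00 w (\bigcup_n B n).
  apply: nondecreasing_cvg_mu => //; first exact: bigcupT_measurable.
  move=> m n mn; apply/subsetPset => z; rewrite /B /= => /le_trans; apply.
  by rewrite ler_nat.
have c1 : N le00 w (B n) @[n --> \oo] --> 1.
  rewrite (_ : (fun n => _) = (fun n => (1 - expR (- hazard (w, n%:R)))%:E)); last first.
    by apply/funext => n; exact: stage_ker_le.
  apply: cvg_EFin; first exact: nearW.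
  rewrite -[X in _ --> X]subr0; apply: cvgB; first exact: cvg_cst.
  apply: (@cvg_comp _ _ _ (fun n : nat => hazard (w, n%:R)) (fun x => expR (- x)) _ +oo%R);
    last exact: cvgr_expR.
  apply/cvgryPge => K; near=> n.
  apply: (@le_trans _ _ (lo * n%:R)%R).
    rewrite mulrC -ler_pdivrMr//; near: n; exact: nbhs_infty_ger.
  exact: (hazard_ge_lo lo_gt0 lam_bounds).
exact: cvg_unique cN c1.
Unshelve. all: by end_near. Qed.

Lemma stage_ker_gt t : (0 <= t)%R ->
  N le00 w [set z | (t < z.2.1)%R] = (expR (- hazard (w, t)))%:E.
Proof.
move=> t0.
have -> : [set z : W * (time * (E * E)) | (t < z.2.1)%R] = ~` [set z | (z.2.1 <= t)%R].
  by apply/seteqP; split => z /=; [move=> tz; rewrite leNgt tz|move/negP; rewrite ltNge].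
have mt : measurable [set z : W * (time * (E * E)) | (z.2.1 <= t)%R].
  rewrite -[X in measurable X]setTI.
  exact: (mtime measurableT (measurable_itv `]-oo, t])).
rewrite -setTD measureD//; last first.
  by rewrite [ltLHS]stage_ker_setT ltry.
rewrite setTI; transitivity (1 - (1 - expR (- hazard (w, t)))%:E).
  by congr (_ - _); [exact: stage_ker_setT|exact: stage_ker_le].
by rewrite -EFinB; congr (_%:E); rewrite opprB addrC subrK.
Qed.

Lemma integral_stage_ker_before_jump (h : time -> \bar R) :
  (forall u, 0 <= h u) -> measurable_fun setT h ->
  \int[N le00 w]_z \int[leb]_(u in [set u : R | (0 <= u < z.2.1)%R]) h u =
  \int[leb]_(u in Rge0) ((expR (- hazard (w, u)))%:E * h u).
Proof.
move=> h0 mh.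
pose f (z : time * time) : \bar R :=
  (\1_[set z : time * time | (0 <= z.2)%R /\ (z.2 < z.1)%R] z)%:E * h z.2.
have mf : measurable_fun setT f.
  apply: emeasurable_funM; last exact: measurableT_comp.
  apply/measurable_EFinP; apply: measurable_indic.
  apply: measurableI; rewrite -[X in measurable X]setTI.
    exact: measurable_fun_le.
  exact: (measurable_fun_ltr measurable_snd measurable_fst measurableT (_ : measurable [set true])).
have f0 z : 0 <= f z by rewrite /f mule_ge0.
have fE t : \int[leb]_(u in [set u : R | (0 <= u < t)%R]) h u = \int[leb]_u f (t, u).
  rewrite integral_mkcond; apply: eq_integral => u _; rewrite patchE /f indicE /=.
  case: ifPn => [/set_mem /= /andP[u0 ut]|/negP ut]; first by rewrite mem_set ?mul1e.
  by rewrite memNset ?mul0e// => -[u0 ut']; apply: ut; apply: mem_set => /=; apply/andP.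
under eq_integral do rewrite fE.
have mfI := @measurable_fun_fubini_tonelli_F _ _ _ _ _ leb f mf f0.
rewrite (integral_stage_ker0_time (f := fun t => \int[leb]_u f (t, u)))//; last first.
  by move=> u; exact: integral_ge0.
rewrite integral_Rge0.
pose g (z : time * time) : \bar R :=
  (\1_[set u : R | (0 <= u)%R] z.1)%:E * (density z.1)%:E * f z.
have mg1 : measurable_fun setT (fun z : time => (\1_[set u : R | (0 <= u)%R] z)%:E * (density z)%:E).
  apply: emeasurable_funM; apply/measurable_EFinP => //.
  by apply: measurable_indic; exact: measurable_Rge0.
have mg : measurable_fun setT g.
  by apply: emeasurable_funM => //; exact: (measurableT_comp mg1 measurable_fst).
have g0 z : 0 <= g z by rewrite /g !mule_ge0// lee_fin.
(* Here t is the jump time with its density and u a time before the jump. Exchanging the order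
   leaves, for each u, the mass of the jumps after u. *)
transitivity (\int[leb]_t \int[leb]_u g (t, u)).
  apply: eq_integral => t _; rewrite muleA -ge0_integralZl//.
  - exact: (measurableT_comp mf (pair1_measurable t)).
  - by rewrite mule_ge0// lee_fin.
rewrite (@fubini_tonelli _ _ _ _ _ leb leb g mg g0) integral_Rge0; apply: eq_integral => u _ /=.
rewrite indicE; case: (boolP (_ \in _)) => [/set_mem /= u0|/negP u0]; last first.
  rewrite mul0e integral0_eq// => t _; rewrite /g.
  have -> : f (t, u) = 0; last by rewrite mule0.
  rewrite /f indicE memNset ?mul0e//= => -[u0' _]; apply: u0; exact: mem_set.
rewrite mul1e -stage_ker_gt// (stage_timeE (B := [set t | (u < t)%R])); last first.
  by rewrite -set_itvoy; exact: measurable_itv.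
have mu : measurable_fun setT (fun t : time => (\1_[set t : R | (u < t)%R] t)%:E : \bar R).
  by apply/measurable_EFinP; apply: measurable_indic; rewrite -set_itvoy; exact: measurable_itv.
rewrite integral_Rge0 -ge0_integralZr//.
- apply: eq_integral => t _; rewrite /g /f /= -!muleA; congr (_ * (_ * _)).
  congr (_%:E * _); rewrite !indicE; congr (nat_of_bool _)%:R.
  by apply/idP/idP => /set_mem /=; [move=> [_ ?]; exact/mem_set|move=> ?; exact/mem_set].
- apply: emeasurable_funM; last apply: emeasurable_funM => //.
    apply/measurable_EFinP; apply: measurable_indic; exact: measurable_Rge0.
  exact/measurable_EFinP.
- by move=> t _; rewrite !mule_ge0// lee_fin.
Qed.

(** Integrate the pointwise bound e^{-u} + (1 - e^{-1}) 1(u > 1) <= 1 for u >= 0, and use that the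
    first jump comes after time 1 with probability at least e^{-hi}. *)
Lemma stage_ker_expN_le :
  \int[N le00 w]_z (expR (- z.2.1))%:E <=
    (1 - expR (- hi) * (1 - expR (- 1)))%:E.
Proof.
pose c : R := (1 - expR (- 1))%R.
have c0 : (0 <= c)%R.
  have : (expR (- 1) <= expR 0 :> R)%R by rewrite ler_expR; lra.
  by rewrite expR0 /c subr_ge0.
pose f (u : time) : \bar R := (expR (- u))%:E.
pose g (u : time) : \bar R := c%:E * (\1_[set u : R | (1 < u)%R] u)%:E.
have mf : measurable_fun setT f.
  by apply/measurable_EFinP; apply: measurableT_comp; first exact: measurable_expR.
have mi : measurable_fun setT (fun u : time => (\1_[set u : R | (1 < u)%R] u)%:E : \bar R).
  by apply/measurable_EFinP; apply: measurable_indic; rewrite -set_itvoy; exact: measurable_itv.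
have mg : measurable_fun setT g by exact: measurable_funeM.
have f0 u : 0 <= f u by rewrite lee_fin expR_ge0.
have g0 u : 0 <= g u by rewrite mule_ge0.
have N1 : \int[leb]_(u in Rge0) ((density u)%:E * 1) = 1.
  rewrite -(integral_stage_ker0_time (f := cst 1))//.
  transitivity (1 * N le00 w setT); first exact: integral_cst.
  by rewrite mul1e; exact: stage_ker_setT.
have Ng : \int[leb]_(u in Rge0) ((density u)%:E * g u) = (c * expR (- hazard (w, 1%R)))%:E.
  transitivity (c%:E * N le00 w [set z | (1 < z.2.1)%R]); last first.
    by rewrite EFinM; congr (_ * _); exact: stage_ker_gt.
  rewrite (stage_timeE (B := [set t | (1 < t)%R])); last first.
    by rewrite -set_itvoy; exact: measurable_itv.
  rewrite -ge0_integralZl//.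
  - by apply: eq_integral => u _; rewrite /g muleCA.
  - exact: measurable_Rge0.
  - by apply/measurable_funTS/emeasurable_funM => //; exact/measurable_EFinP.
  - by move=> u _; rewrite mule_ge0// lee_fin.
have fg : \int[leb]_(u in Rge0) ((density u)%:E * f u) + (c * expR (- hazard (w, 1%R)))%:E <= 1.
  rewrite -Ng -N1 -ge0_integralD//.
  - apply: ge0_le_integral => //.
    + exact: measurable_Rge0.
    + by move=> u _; rewrite adde_ge0// mule_ge0// lee_fin.
    + apply/measurable_funTS/emeasurable_funD; apply: emeasurable_funM => //;
        exact/measurable_EFinP.
    + apply/measurable_funTS; apply: emeasurable_funM => //; exact/measurable_EFinP.
    + move=> u u0; rewrite -ge0_muleDr// lee_wpmul2l ?lee_fin//.
      rewrite indicE.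
      have [/set_mem /= u1|_] := boolP (_ \in _).
        rewrite mulr1 /c addrCA gerDl subr_le0 ler_expR lerN2; exact: ltW.
      by rewrite mulr0 addr0 -expR0 ler_expR oppr_le0.
  - exact: measurable_Rge0.
  - by move=> u _; rewrite mule_ge0// lee_fin.
  - apply/measurable_funTS; apply: emeasurable_funM => //; exact/measurable_EFinP.
  - by move=> u _; rewrite mule_ge0// lee_fin.
  - apply/measurable_funTS; apply: emeasurable_funM => //; exact/measurable_EFinP.
rewrite (integral_stage_ker0_time (f := f))//.
have hz : (hazard (w, 1%R) <= hi)%R.
  by have := hazard_le_hi lo_gt0 lam_bounds mphi mrho w ler01; rewrite mulr1.
apply: (@le_trans _ _ (1 - (c * expR (- hazard (w, 1%R)))%:E)).
  by rewrite leeBrDr.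
rewrite -EFinB lee_fin lerD2l lerN2 mulrC -/c ler_wpM2l// ler_expR lerN2//.
Qed.

End stage_consequences.

(** Extension by a constant turns flows and policies, measurable on nonnegative times only, into the
    total maps that the stage kernel takes. *)
Lemma measurable_fun_patch dX (X : measurableType dX) dY (Y : measurableType dY)
    (D : set X) (f : X -> Y) (c : Y) : measurable D -> measurable_fun D f ->
  measurable_fun setT (fun x => if x \in D then f x else c).
Proof.
move=> mD mf _ B mB; rewrite setTI.
have -> : (fun x => if x \in D then f x else c) @^-1` B =
    (D `&` f @^-1` B) `|` (~` D `&` (cst c : X -> Y) @^-1` B).
  apply/seteqP; split => x /=.
    by case: ifPn => [/set_mem Dx Bx|/negP Dx Bc]; [left|right; split => // ?; apply: Dx;
        exact: mem_set].
  by move=> [[Dx Bx]|[Dx Bc]]; [rewrite mem_set|rewrite memNset].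
apply: measurableU; first exact: mf.
exact: (@measurable_cst _ _ _ _ (~` D) c (measurableC mD) _ mB).
Qed.

Lemma measurable_fun_pair_on dX (X : measurableType dX) dY (Y : measurableType dY)
    dZ (Z : measurableType dZ) (D : set X) (f : X -> Y) (g : X -> Z) :
  measurable D -> measurable_fun D f -> measurable_fun D g ->
  measurable_fun D (fun x => (f x, g x)).
Proof.
move=> mD mf mg.
apply: (eq_measurable_fun (fun x => (if x \in D then f x else point,
                                     if x \in D then g x else point))).
  by move=> x xD /=; rewrite xD.
by apply: measurable_funTS; apply: measurable_fun_pair; exact: measurable_fun_patch.
Qed.

(** * Trajectories as parameter space of the stage kernel *)

Section trajectories.
Context {R : realType} {d : nat} {A : pmetricType R} (M : pdmdp d A).
Local Notation E := (state R d).
Local Notation time := (measurableTypeR R).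
Variables (p : policyP d A) (q : policyD d A).

Lemma measurable_hist_space n : measurable (@hist_space R d A n).
Proof.
elim: n => [|n ih] /=; first exact: measurableT.
apply: measurableI.
  rewrite -[X in measurable X]setTI.
  have m1 : measurable_fun setT (fun h : hist d A n.+1 => h.1.1.1).
    apply: (measurableT_comp measurable_fst); exact: (measurableT_comp measurable_fst measurable_fst).
  exact: (m1 measurableT _ ih).
rewrite -[X in measurable X]setTI.
have m2 : measurable_fun setT (fun h : hist d A n.+1 => h.1.2).
  exact: (measurableT_comp measurable_snd measurable_fst).
exact: (m2 measurableT _ measurable_Rge0).
Qed.

(** The counterpart of [hist_space], to which both the measurability of policies and [corresponding]
    are restricted. *)
Fixpoint traj_ok n : set (@traj R d n) :=
  match n return set (@traj R d n) with
  | 0 => setT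
  | m.+1 => [set w | @traj_ok m w.1 /\ 0 <= w.2.1]
  end.

Lemma measurable_traj_ok n : measurable (@traj_ok n).
Proof.
elim: n => [|n ih] /=; first exact: measurableT.
apply: measurableI; rewrite -[X in measurable X]setTI.
  exact: (measurable_fst measurableT _ ih).
have m2 : measurable_fun setT (fun h : @traj R d n.+1 => h.2.1).
  exact: (measurableT_comp measurable_fst measurable_snd).
exact: (m2 measurableT _ measurable_Rge0).
Qed.

Lemma traj_hist_space n (w : @traj R d n) : traj_ok w -> hist_space (traj_hist q w).
Proof. by elim: n w => [//|n ih] w /= [/ih h s0]. Qed.

Lemma measurable_traj_last n : measurable_fun setT (@traj_last R d n).
Proof.
case: n => [|n] /=; first exact: measurable_fst.
by apply: (measurableT_comp measurable_fst); exact: (measurableT_comp measurable_snd measurable_snd).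
Qed.

(** Conditional on the measurability of [traj_hist] at n, because the history at n+1 contains the
    value of [q n]: the two facts are proved in one recursion. *)
Lemma measurable_policy_traj n :
  measurable_fun (@traj_ok n) (@traj_hist R d A q n) ->
  measurable_fun (@traj_ok n) (fun w => q n (traj_hist q w)).
Proof.
move=> mh; apply: (measurable_comp (@measurable_hist_space n) _ (@policyD_measurable _ _ _ q n) mh).
by move=> _ [w wok <-]; exact: traj_hist_space.
Qed.

Lemma measurable_traj_hist n : measurable_fun (@traj_ok n) (@traj_hist R d A q n).
Proof.
elim: n => [|n ih] /=; first exact: measurable_snd.
have mf : measurable_fun (@traj_ok n.+1) (fun w : @traj R d n.+1 => w.1).
  exact: measurable_funTS measurable_fst.
have sub : [set w.1 | w in @traj_ok n.+1] `<=` @traj_ok n by move=> _ [w [wok _] <-].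
suff : measurable_fun (@traj_ok n.+1) (fun w : @traj R d n.+1 =>
    ((traj_hist q w.1, q n (traj_hist q w.1), w.2.1, w.2.2.2) :
      (hist d A n * relaxed A * time * E)%type)) by [].
have mD := @measurable_traj_ok n.+1.
apply: measurable_fun_pair_on => //; [apply: measurable_fun_pair_on => //;
    [apply: measurable_fun_pair_on => //|]|].
- exact: (measurable_comp (@measurable_traj_ok n) sub ih mf).
- exact: (measurable_comp (@measurable_traj_ok n) sub (measurable_policy_traj ih) mf).
- apply: measurable_funTS; exact: (measurableT_comp measurable_fst measurable_snd).
- apply: measurable_funTS; apply: (measurableT_comp measurable_snd).
  exact: (measurableT_comp measurable_snd measurable_snd).
Qed.

Let dom n : set (@traj R d n * time) := @traj_ok n `*` Rge0.

Let measurable_dom n : measurable (@dom n).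
Proof. by apply: measurableX; [exact: measurable_traj_ok|exact: measurable_Rge0]. Qed.

(* Policies and flows are measurable on nonnegative times only; outside, arbitrary constants. *)
Definition traj_flow n (z : @traj R d n * time) : E :=
  if z \in @dom n then Phi M (q n (traj_hist q z.1)) (traj_last z.1, z.2) else (0 : 'rV[R]_d).

Definition traj_control n (z : @traj R d n * time) : probA A :=
  if z \in @dom n then p n (traj_hist q z.1, z.2) else point.

Lemma measurable_traj_flow n : measurable_fun setT (@traj_flow n).
Proof.
apply: measurable_fun_patch => //.
have mf : measurable_fun (@dom n) (fun z : @traj R d n * time => z.1).
  exact: measurable_funTS measurable_fst.
have sub : [set z.1 | z in @dom n] `<=` @traj_ok n by move=> _ [w [wok _] <-].
pose g (z : @traj R d n * time) : (relaxed A * state R d) * time :=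
  ((q n (traj_hist q z.1), traj_last z.1), z.2).
have mg : measurable_fun (@dom n) g.
  apply: measurable_fun_pair_on => //; first apply: measurable_fun_pair_on => //.
  - exact: (measurable_comp (@measurable_traj_ok n) sub
      (measurable_policy_traj (@measurable_traj_hist n)) mf).
  - apply: measurable_funTS; exact: (measurableT_comp (@measurable_traj_last n) measurable_fst).
  - exact: measurable_funTS measurable_snd.
have mS : measurable ([set: relaxed A * state R d] `*` (Rge0 : set time)).
  by apply: measurableX => //; exact: measurable_Rge0.
have gS : [set g z | z in @dom n] `<=` [set: relaxed A * state R d] `*` (Rge0 : set time).
  by move=> _ [w [_ w0] <-].
exact: (measurable_comp mS gS (Phi_measurable M) mg).
Qed.

Lemma measurable_traj_control n : measurable_fun setT (@traj_control n).
Proof.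
apply: measurable_fun_patch => //.
have mf : measurable_fun (@dom n) (fun z : @traj R d n * time => z.1).
  exact: measurable_funTS measurable_fst.
have sub : [set z.1 | z in @dom n] `<=` @traj_ok n by move=> _ [w [wok _] <-].
pose g (z : @traj R d n * time) : hist d A n * time := (traj_hist q z.1, z.2).
have mg : measurable_fun (@dom n) g.
  apply: measurable_fun_pair_on => //.
    exact: (measurable_comp (@measurable_traj_ok n) sub (@measurable_traj_hist n) mf).
  exact: measurable_funTS measurable_snd.
have mS : measurable (@hist_space R d A n `*` (Rge0 : set time)).
  by apply: measurableX; [exact: measurable_hist_space|exact: measurable_Rge0].
have gS : [set g z | z in @dom n] `<=` @hist_space R d A n `*` (Rge0 : set time).
  by move=> _ [w [wok w0] <-]; split => //=; exact: traj_hist_space.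
exact: (measurable_comp mS gS (@policyP_measurable _ _ _ p n) mg).
Qed.

Lemma traj_flowE n (w : @traj R d n) (t : R) : traj_ok w -> 0 <= t ->
  traj_flow (w, t) = Phi M (q n (traj_hist q w)) (traj_last w, t).
Proof. by move=> wok t0; rewrite /traj_flow mem_set. Qed.

Lemma traj_controlE n (w : @traj R d n) (t : R) : traj_ok w -> 0 <= t ->
  traj_control (w, t) = p n (traj_hist q w, t).
Proof. by move=> wok t0; rewrite /traj_control mem_set. Qed.

End trajectories.

Lemma ae_impl dX (X : measurableType dX) (R : realType) (m : {measure set X -> \bar R})
    (P Q : X -> Prop) : (forall x, P x -> Q x) -> {ae m, forall x, P x} -> {ae m, forall x, Q x}.
Proof. by move=> PQ; apply: filterS. Qed.

(** * The integrals of the model expressed by the stage kernel *)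

Section correspondence.
Context {R : realType} {d : nat} {A : pmetricType R} (M : pdmdp d A).
Local Notation E := (state R d).
Local Notation time := (measurableTypeR R).
Variables (p : policyP d A) (q : policyD d A) (pq : corresponding p q).

(** Almost everywhere equality of controls is equality of classes. The default branch of
    [relaxed_of] does not occur, since the section of [p n] at h is measurable on nonnegative
    times. *)
Lemma relaxed_of_policy n (h : hist d A n) : hist_space h ->
  relaxed_of (fun t => p n (h, t)) = q n h.
Proof.
move=> hh; rewrite /relaxed_of; case: pselect => [mf|nmf].
  rewrite -[RHS](@reprK _ (control_quot A)); apply/eqquotP.
  by apply/asboolP; exact: pq.
exfalso; apply: nmf.
have mS : measurable (@hist_space R d A n `*` (Rge0 : set time)).
  by apply: measurableX; [exact: measurable_hist_space|exact: measurable_Rge0].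
have mg : measurable_fun (Rge0 : set time) (fun t : time => (h, t)).
  by apply: measurable_funTS; exact: pair1_measurable.
have gS : [set (h, t) | t in (Rge0 : set time)] `<=` @hist_space R d A n `*` (Rge0 : set time).
  by move=> _ [t t0 <-].
exact: (measurable_comp mS gS (@policyP_measurable _ _ _ p n) mg).
Qed.

Variables (lo hi : R) (lo_gt0 : 0 < lo)
  (lam_bounds : forall ya : 'rV[R]_d * A, lo <= lamA M ya <= hi).
Local Open Scope ereal_scope.
Variable n : nat.
Local Notation W := (@traj R d n).
Local Notation phi := (@traj_flow R d A M q n).
Local Notation rho := (@traj_control R d A p q n).
Local Notation mphi := (@measurable_traj_flow R d A M q n).
Local Notation mrho := (@measurable_traj_control R d A p q n).
Local Notation N b0 := (stage_ker lo_gt0 lam_bounds mphi mrho b0).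
Let prob (z : W * time) : probability (borel A) R := rho z.
Local Notation hazard := (hazard M phi rho).

Section fixed_trajectory.
Variables (w : W) (wok : traj_ok w).
Local Notation r := (q n (traj_hist q w)).
Local Notation y := (traj_last w).

(** The exceptional set of times is independent of f, so under a time integral the action integral
    may be rewritten whatever its integrand. *)
Lemma ae_ctrl_control : {ae leb, forall t : R, Rge0 t -> forall f : A -> \bar R,
  \int[ctrl r t : probability (borel A) R]_a f a = \int[prob (w, t)]_a f a}.
Proof.
have := pq (traj_hist_space q wok); apply: filterS => t h t0 f.
apply: eq_setfun_integral => B mB; rewrite /prob traj_controlE//.
by rewrite h.
Qed.

Let lam_ge0 ya : (0 <= lamA M ya)%R.
Proof. by have /andP[+ _] := lam_bounds ya; apply: le_trans; exact: ltW. Qed.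

Lemma LambdaE (t : R) : Lambda M r y t = hazard (w, t).
Proof.
rewrite /Lambda /hazard /Rintegral; congr fine.
apply: ge0_ae_eq_integral_nonmeas.
- by move=> u _; rewrite lee_fin; apply: Rintegral_ge0 => a _; exact: lam_ge0.
- by move=> u _; rewrite lee_fin; exact: (rate_ge0 lo_gt0 lam_bounds rho mphi).
apply: ae_impl ae_ctrl_control => u h /= /andP[u0 ut].
by rewrite /rate /Rintegral /= h// traj_flowE.
Qed.

Lemma GammaE (t : R) : Gamma M r y t = (discount M * t + hazard (w, t))%R.
Proof. by rewrite /Gamma LambdaE. Qed.

Lemma stage_costE : stage_cost M y r =
  \int[leb]_(t in Rge0) ((expR (- (discount M * t + hazard (w, t))))%:E *
    \int[prob (w, t)]_a (cost M (phi (w, t), a))%:E).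
Proof.
apply: ge0_ae_eq_integral_nonmeas.
- move=> t t0; rewrite mule_ge0 ?lee_fin ?expR_ge0//.
  by apply: integral_ge0 => a _; rewrite lee_fin; exact: cost_ge0.
- move=> t t0; rewrite mule_ge0 ?lee_fin ?expR_ge0//.
  by apply: integral_ge0 => a _; rewrite lee_fin; exact: cost_ge0.
apply: ae_impl ae_ctrl_control => t h t0.
by rewrite GammaE traj_flowE// -h.
Qed.

Let Qeps_preimage (D : set E) (y' : E) :
  [set (z - y' : 'rV[R]_d)%R | z in D] = [set e : E | D (e + y' : 'rV[R]_d)%R].
Proof.
apply/seteqP; split => [_ [z Dz <-] /=|e /= De]; first by rewrite subrK.
by exists (e + y')%R => //; rewrite addrK.
Qed.

Let measurable_preimage (B : set (W * (time * (E * E)))) (u : R) (y' : E) : measurable B ->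
  measurable [set e : E | B (w, (u, (y', (e + y' : 'rV[R]_d)%R)))].
Proof.
move=> mB; rewrite -[X in measurable X]setTI.
have mp : measurable_fun setT (fun e : E => (e, y')) by exact: measurable_fun_pair.
have ma := measurableT_comp (@measurable_state_add R d) mp.
have m : measurable_fun setT (fun e : E => (w, (u, (y', (e + y' : 'rV[R]_d)%R)))
    : (W * (time * (E * E)))%type).
  by apply: measurable_fun_pair => //; apply: measurable_fun_pair => //; exact: measurable_fun_pair.
exact: (m measurableT _ mB).
Qed.

Lemma QtildeE (B : set (W * (time * (E * E)))) : measurable B ->
  Qtilde M y r [set z | B (w, z)] = N (discount_ge0 M) w B.
Proof.
move=> mB.
have F0 z : 0 <= (\1_B z : R)%:E by rewrite lee_fin.
have mF : measurable_fun setT (fun z => (\1_B z : R)%:E).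
  by apply/measurable_EFinP; exact: measurable_indic.
rewrite -[RHS]integral_indicT// [RHS](integral_stage_kerE lo_gt0 lam_bounds mphi mrho
    (discount_ge0 M) w F0 mF).
apply: ge0_ae_eq_integral_nonmeas.
- move=> t t0; rewrite mule_ge0 ?lee_fin ?expR_ge0//; apply: integral_ge0 => a _.
  by rewrite mule_ge0 ?lee_fin//; apply: integral_ge0.
- move=> t t0; rewrite mule_ge0 ?lee_fin ?expR_ge0//; apply: integral_ge0 => a _.
  by rewrite mule_ge0 ?lee_fin//; apply: integral_ge0 => y' _; exact: integral_ge0.
apply: ae_impl ae_ctrl_control => u h u0.
rewrite GammaE h// traj_flowE//; congr (_ * _).
apply: eq_integral => a _; congr (_ * _); apply: eq_integral => y' _.
rewrite Qeps_preimage -[LHS]integral_indicT; last exact: measurable_preimage.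
exact: eq_integral.
Qed.

(** The constraints u <= t and y' in C are domains of integration on the left and part of an
    indicator on the right; they are matched one variable at a time. *)
Lemma jump_lawE (t : R) (C D : set E) : measurable C -> measurable D ->
  jump_law M (Lambda M r y) r y t C D =
  N (lexx 0%R) w [set z | [/\ (z.2.1 <= t)%R, C z.2.2.1 & D z.2.2.2]].
Proof.
move=> mC mD; set B := [set z | _].
have mB : measurable B.
  have m1 : measurable_fun setT (fun z : W * (time * (E * E)) => z.2.1).
    exact: (measurableT_comp measurable_fst measurable_snd).
  have m22 : measurable_fun setT (fun z : W * (time * (E * E)) => z.2.2).
    exact: (measurableT_comp measurable_snd measurable_snd).
  have mC' : measurable [set z : W * (time * (E * E)) | C z.2.2.1].
    by rewrite -[X in measurable X]setTI; exact: (measurableT_comp measurable_fst m22 measurableT mC).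
  have mD' : measurable [set z : W * (time * (E * E)) | D z.2.2.2].
    by rewrite -[X in measurable X]setTI; exact: (measurableT_comp measurable_snd m22 measurableT mD).
  have mt' : measurable [set z : W * (time * (E * E)) | (z.2.1 <= t)%R].
    have mt : measurable ([set u | (u <= t)%R] : set time).
      by rewrite -set_itvNyc; exact: measurable_itv.
    by rewrite -[X in measurable X]setTI; exact: (m1 measurableT _ mt).
  rewrite (_ : B = [set z | (z.2.1 <= t)%R] `&` ([set z | C z.2.2.1] `&` [set z | D z.2.2.2])).
    by apply: measurableI => //; exact: measurableI.
  by apply/seteqP; split => z /=; [case|move=> [? [? ?]]].
have F0 z : 0 <= (\1_B z : R)%:E by rewrite lee_fin.
have mF : measurable_fun setT (fun z => (\1_B z : R)%:E).
  by apply/measurable_EFinP; exact: measurable_indic.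
rewrite -[RHS]integral_indicT// [RHS](integral_stage_kerE lo_gt0 lam_bounds mphi mrho (lexx
    0%R) w F0 mF).
rewrite /jump_law integral_mkcond [RHS]integral_mkcond.
apply: ge0_ae_eq_integral_nonmeas.
- move=> u _; apply: erestrict_ge0 => {}u u0; rewrite mule_ge0 ?lee_fin ?expR_ge0//.
  apply: integral_ge0 => a _.
  by rewrite mule_ge0 ?lee_fin//; apply: integral_ge0.
- move=> u _; apply: erestrict_ge0 => {}u u0; rewrite mule_ge0 ?lee_fin ?expR_ge0//.
  apply: integral_ge0 => a _.
  by rewrite mule_ge0 ?lee_fin//; apply: integral_ge0 => y' _; exact: integral_ge0.
apply: ae_impl ae_ctrl_control => u h _; rewrite !patchE.
case: ifPn => [/set_mem /= /andP[u0 ut]|/negP ut].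
  rewrite mem_set// LambdaE h// mul0r add0r traj_flowE//; congr (_ * _).
  apply: eq_integral => a _; congr (_ * _); rewrite integral_mkcond.
  apply: eq_integral => y' _; rewrite patchE; case: ifPn => [/set_mem Cy'|/negP Cy'].
    rewrite Qeps_preimage -[LHS]integral_indicT; last first.
      rewrite -[X in measurable X]setTI.
      have mp : measurable_fun setT (fun e : E => (e, y')) by exact: measurable_fun_pair.
      exact: (measurableT_comp (@measurable_state_add R d) mp measurableT mD).
    apply: eq_integral => e _; rewrite !indicE; congr ((nat_of_bool _)%:R)%:E.
    by apply/idP/idP => /set_mem /= => [De|[_ _ De]]; apply: mem_set => //=; split.
  rewrite integral0_eq// => e _; rewrite indicE memNset// => -[_ /= Cy'' _].
  by apply: Cy'; exact: mem_set.
case: ifPn => // /set_mem u0; rewrite integral0_eq ?mule0// => a _.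
rewrite integral0_eq ?mule0// => y' _; rewrite integral0_eq// => e _.
rewrite indicE memNset// => -[/= ut' _ _]; apply: ut; apply: mem_set => /=.
by rewrite ut' andbT.
Qed.

End fixed_trajectory.
End correspondence.

(** * The discrete-time cost as a sum of discounted means *)

Section discrete_model.
Context {R : realType} {d : nat} {A : pmetricType R} (M : pdmdp d A).
Local Notation E := (state R d).
Local Notation time := (measurableTypeR R).
Variables (p : policyP d A) (q : policyD d A) (pq : corresponding p q).
Variables (lo hi : R) (lo_gt0 : 0 < lo)
  (lam_bounds : forall ya : 'rV[R]_d * A, lo <= lamA M ya <= hi).
Variable x : E.
Local Open Scope ereal_scope.

Definition traj_stage_ker (b : R) (b0 : (0 <= b)%R) n :
    R.-sfker (@traj R d n) ~> (@traj R d n * (time * (E * E)))%type :=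
  stage_ker lo_gt0 lam_bounds (@measurable_traj_flow R d A M q n)
    (@measurable_traj_control R d A p q n) b0.

Local Notation N n := (@traj_stage_ker _ (discount_ge0 M) n).
Local Notation hazard n := (hazard M (@traj_flow R d A M q n) (@traj_control R d A p q n)).

(** Backward integration along n discounted kernels from (y, x). This is the meeting point of the
    two models: integrated over [Q0] it is the integral against [traj_law], and by
    [discounted_meanE] it is the expectation of e^{-beta T_n} f(h_n). *)
Fixpoint discounted_mean n : (@traj R d n -> \bar R) -> E -> \bar R :=
  match n return (@traj R d n -> \bar R) -> E -> \bar R with
  | 0 => fun f y => f (y, x)
  | m.+1 => fun f y => @discounted_mean m (fun w => \int[N m w]_z f z) y
  end.

Lemma measurable_stage_integral b (b0 : (0 <= b)%R) n (f : @traj R d n * (time * (E * E)) -> \bar R) :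
  (forall z, 0 <= f z) -> measurable_fun setT f ->
  measurable_fun setT (fun w : @traj R d n => \int[traj_stage_ker b0 n w]_z f z).
Proof.
move=> f0 mf.
exact: (measurable_fun_integral_kernel (measurable_kernel (traj_stage_ker b0 n)) f0 mf).
Qed.

Lemma discounted_mean_ge0 n (f : @traj R d n -> \bar R) y :
  (forall z, 0 <= f z) -> 0 <= discounted_mean f y.
Proof.
elim: n f => [|n ih] f f0 /=; first exact: f0.
by apply: ih => w; exact: integral_ge0.
Qed.

Lemma measurable_discounted_mean n (f : @traj R d n -> \bar R) :
  (forall z, 0 <= f z) -> measurable_fun setT f ->
  measurable_fun setT (discounted_mean f).
Proof.
elim: n f => [|n ih] f f0 mf /=.
  by apply: (measurableT_comp mf); exact: measurable_fun_pair.
apply: ih; first by move=> w; exact: integral_ge0.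
exact: measurable_stage_integral.
Qed.

Lemma stage_ker_traj_ok b (b0 : (0 <= b)%R) n (w : @traj R d n) : traj_ok w ->
  traj_stage_ker b0 n w (~` @traj_ok R d n.+1) = 0.
Proof.
move=> wok.
have mB : measurable (~` @traj_ok R d n.+1) by apply: measurableC; exact: measurable_traj_ok.
rewrite -[LHS]integral_indicT//.
have F0 (z : @traj R d n * (time * (E * E))) : 0 <= (\1_(~` @traj_ok R d n.+1) z
    : R)%:E by rewrite lee_fin.
have mF : measurable_fun setT (fun z : @traj R d n * (time * (E * E)) => (\1_(~` @traj_ok R d
    n.+1) z : R)%:E).
  by apply/measurable_EFinP; exact: measurable_indic.
rewrite [LHS](integral_stage_kerE lo_gt0 lam_bounds _ _ b0 w F0 mF).
apply: integral0_eq => u u0; rewrite integral0_eq ?mule0// => a _.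
rewrite integral0_eq ?mule0// => y' _; rewrite integral0_eq// => e _.
by rewrite indicE memNset//= => -[].
Qed.

(** A kernel out of [unit] is a convenient form of a measure, as composition is available for it.
    The three claims are proved together: the recursive step integrates against the previous law,
    and [QtildeE] holds on [traj_ok] only. *)
Lemma traj_law_kernel n : exists k : R.-sfker unit ~> @traj R d n,
  [/\ forall f : @traj R d n -> \bar R, (forall z, 0 <= f z) -> measurable_fun setT f ->
        \int[k tt]_w f w = \int[Q0 M x]_y discounted_mean f y,
      forall B, measurable B -> @traj_law R d A M q x n B = k tt B &
      {ae k tt, forall w, traj_ok w}].
Proof.
elim: n => [|n [k [kf kl kok]]].
  have mx : measurable_fun setT (fun z : unit * E => (z.2, x) : (E * E)%type).
    by apply: measurable_fun_pair => //; exact: measurable_snd.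
  pose kd : R.-sfker (unit * E) ~> (E * E)%type := kdirac mx.
  pose k0 : R.-sfker unit ~> E := kprecomp (Q0 M) (@measurable_cst _ _ unit E setT x).
  pose k : R.-sfker unit ~> (E * E)%type := mkcomp k0 kd.
  have kf f : (forall z, 0 <= f z) -> measurable_fun setT f ->
      \int[k tt]_w f w = \int[Q0 M x]_y f (y, x).
    move=> f0 mf; rewrite [LHS]integral_kcomp//; apply: eq_integral => y _.
    by rewrite integral_dirac// diracT mul1e.
  exists k; split => //.
    move=> B mB; rewrite -[RHS]integral_indicT//.
    rewrite [RHS]kf; last first.
      by apply/measurable_EFinP; exact: measurable_indic.
      by move=> z; rewrite lee_fin.
    rewrite /= -[LHS]integral_indicT//.
    have mp : measurable_fun setT (fun y : E => (y, x) : (E * E)%type) by exact: measurable_fun_pair.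
    by rewrite -[X in measurable X]setTI; exact: mp.
  by apply: aeW.
pose k' : R.-sfker unit ~> @traj R d n.+1 := mkcomp k (sfkprecomp (N n) measurable_snd).
have k'f f : (forall z, 0 <= f z) -> measurable_fun setT f ->
    \int[k' tt]_w f w = \int[k tt]_w \int[N n w]_z f z.
  by move=> f0 mf; rewrite [LHS]integral_kcomp.
exists k'; split => [f f0 mf|B mB|].
- rewrite k'f// kf//; first by move=> w; exact: integral_ge0.
  exact: measurable_stage_integral.
- transitivity (\int[k tt]_w N n w B); last by [].
  (* The integrating set function is replaced by [k tt] first; then the integrand may be changed off
     the null set of trajectories with a negative sojourn time. *)
  rewrite /= (eq_setfun_integral _ _ kl); apply: ge0_ae_eq_integral_nonmeas => //.
    move=> w _; apply: integral_ge0 => u u0; rewrite mule_ge0 ?lee_fin ?expR_ge0//.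
    apply: integral_ge0 => a _; rewrite mule_ge0//; last exact: integral_ge0.
    rewrite lee_fin; have /andP[+ _] := lam_bounds (Phi M (q n (traj_hist q w)) (traj_last w, u), a).
    by apply: le_trans; exact: ltW.
  by apply: ae_impl kok => w wok _; exact: (QtildeE pq lo_gt0 lam_bounds wok mB).
- exists (~` @traj_ok R d n.+1); split => //.
    by apply: measurableC; exact: measurable_traj_ok.
  transitivity (\int[k tt]_w N n w (~` @traj_ok R d n.+1)); first by [].
  transitivity (\int[k tt]_w (0 : \bar R)); last by rewrite integral0.
  apply: ge0_ae_eq_integral_nonmeas => //.
  by apply: ae_impl kok => w wok _; exact: stage_ker_traj_ok.
Qed.

Definition running_cost n (z : @traj R d n * time) : \bar R :=
  \int[traj_control p q z : probability (borel A) R]_a (cost M (traj_flow M q z, a))%:E.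

Lemma running_cost_ge0 n (z : @traj R d n * time) : 0 <= running_cost z.
Proof. by apply: integral_ge0 => a _; rewrite lee_fin; exact: cost_ge0. Qed.

Lemma measurable_running_cost n : measurable_fun setT (@running_cost n).
Proof.
apply: (measurable_integral_probA (@measurable_traj_control R d A p q n)
  (f := fun z => (cost M (traj_flow M q z.1, z.2))%:E)).
  by move=> z; rewrite lee_fin; exact: cost_ge0.
apply/measurable_EFinP; apply: (measurableT_comp (@cost_measurable _ _ _ M)).
apply: measurable_fun_pair; last exact: measurable_snd.
exact: (measurableT_comp (@measurable_traj_flow R d A M q n) measurable_fst).
Qed.

Definition expected_cost n (w : @traj R d n) : \bar R :=
  \int[leb]_(t in Rge0) ((expR (- (discount M * t + hazard n (w, t))))%:E *
    running_cost (w, t)).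

Lemma expected_cost_ge0 n (w : @traj R d n) : 0 <= expected_cost w.
Proof.
apply: integral_ge0 => t t0; rewrite mule_ge0 ?lee_fin ?expR_ge0//.
exact: running_cost_ge0.
Qed.

Lemma measurable_expected_cost n : measurable_fun setT (@expected_cost n).
Proof.
pose f (z : @traj R d n * time) : \bar R := (\1_[set u : R | (0 <= u)%R] z.2)%:E *
  ((expR (- (discount M * z.2 + hazard n z)))%:E * running_cost z).
have f0 z : 0 <= f z.
  by rewrite /f !mule_ge0 ?lee_fin ?expR_ge0//; exact: running_cost_ge0.
have mf : measurable_fun setT f.
  apply: emeasurable_funM; last apply: emeasurable_funM.
  - apply/measurable_EFinP; apply: (measurableT_comp _ measurable_snd).
    by apply: measurable_indic; exact: measurable_Rge0.
  - apply/measurable_EFinP; apply: measurableT_comp; first exact: measurable_expR.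
    apply: measurableT_comp => //; apply: measurable_funD.
      by apply: measurable_funM => //; exact: measurable_snd.
    exact: (measurable_hazard lo_gt0 lam_bounds (@measurable_traj_flow R d A M q n)
      (@measurable_traj_control R d A p q n)).
  - exact: measurable_running_cost.
have := @measurable_fun_fubini_tonelli_F _ _ _ _ _ leb f mf f0.
by congr (measurable_fun _ _); apply/funext => w; rewrite /expected_cost integral_Rge0.
Qed.

Lemma JtildeE : Jtilde M q x =
  \int[Q0 M x]_y \sum_(0 <= n <oo) discounted_mean (@expected_cost n) y.
Proof.
rewrite integral_nneseries//; last 2 first.
- by move=> n; apply: measurable_discounted_mean;
    [exact: expected_cost_ge0|exact: measurable_expected_cost].
- by move=> n y _; apply: discounted_mean_ge0; exact: expected_cost_ge0.
apply: eq_eseriesr => n _; have [k [kf kl kok]] := traj_law_kernel n.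
rewrite -kf; [|exact: expected_cost_ge0|exact: measurable_expected_cost].
rewrite (eq_setfun_integral _ _ kl); apply: ge0_ae_eq_integral_nonmeas => //.
- move=> w _; apply: integral_ge0 => t t0; rewrite mule_ge0 ?lee_fin ?expR_ge0//.
  by apply: integral_ge0 => a _; rewrite lee_fin; exact: cost_ge0.
- by move=> w _; exact: expected_cost_ge0.
by apply: ae_impl kok => w wok _; exact: (stage_costE pq lo_gt0 lam_bounds wok).
Qed.

End discrete_model.

(** * Uniqueness of the joint law of a trajectory and its next step *)

Section step_law_uniqueness.
Local Open Scope ereal_scope.
Context {R : realType} dW (W : measurableType dW) d1 (E1 : measurableType d1)
  d2 (E2 : measurableType d2).
Local Notation time := (measurableTypeR R).
Local Notation T := (W * (time * (E1 * E2)))%type.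

(** Restricting to K freezes the other factors, and the image under f isolates the factor in which
    the class of sets is to be enlarged. *)
Let slice (m : {measure set T -> \bar R}) (K : set T) (mK : measurable K)
    dU (U : measurableType dU) (f : T -> U) (mf : measurable_fun setT f) :
  {measure set U -> \bar R} := pushm (mrestr m mK) mf.

Let slice_fin (m : {measure set T -> \bar R}) K (mK : measurable K)
    dU (U : measurableType dU) (f : T -> U) (mf : measurable_fun setT f) :
  m setT < +oo -> slice m mK mf setT < +oo.
Proof.
move=> moo; apply: le_lt_trans moo; rewrite /slice pushmE /mrestr.
apply: le_measure; rewrite ?inE//.
by rewrite preimage_setT setTI.
Qed.

(** Agreement is extended in four stages: from rays to Borel sets of times, from C x D to sets of
    (state, observation) pairs, then to sets of steps, and finally to the whole product. *)
Lemma step_measure_unique (m1 m2 : {measure set T -> \bar R}) :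
  m1 setT < +oo ->
  (forall B C D (t : R), measurable B -> measurable C -> measurable D ->
    m1 (B `*` (`]-oo, t]%classic `*` (C `*` D))) = m2 (B `*` (`]-oo, t]%classic `*` (C `*` D)))) ->
  forall K, measurable K -> m1 K = m2 K.
Proof.
move=> moo mm.
have mt : measurable_fun setT (fun z : T => z.2.1).
  exact: (measurableT_comp measurable_fst measurable_snd).
have me : measurable_fun setT (fun z : T => z.2.2).
  exact: (measurableT_comp measurable_snd measurable_snd).
have pre dU (U : measurableType dU) (f : T -> U) V : measurable_fun setT f ->
    measurable V -> measurable [set z | V (f z)].
  by move=> mf mV; rewrite -[X in measurable X]setTI; exact: (mf measurableT _ mV).
have mA B A C D : measurable B -> measurable A -> measurable C -> measurable D ->
    m1 (B `*` (A `*` (C `*` D))) = m2 (B `*` (A `*` (C `*` D))).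
  move=> mB mA mC mD.
  pose K := B `*` ([set: time] `*` (C `*` D)).
  have mK : measurable K by do 3 (apply: measurableX => //).
  have E m A' : slice m mK mt A' = m (B `*` (A' `*` (C `*` D))).
    rewrite /slice pushmE /mrestr; congr (m _); apply/seteqP.
    by split => z /=; [move=> [? [? [_ ?]]]|move=> [? [? ?]]].
  rewrite -!E; apply: ray_measure_unique => // [|t]; first exact: slice_fin.
  by rewrite !E; exact: mm.
have mAF B A F : measurable B -> measurable A -> measurable F ->
    m1 (B `*` (A `*` F)) = m2 (B `*` (A `*` F)).
  move=> mB mA' mF.
  pose K := B `*` (A `*` [set: E1 * E2]).
  have mK : measurable K by do 2 (apply: measurableX => //).
  have E m F' : slice m mK me F' = m (B `*` (A `*` F')).
    rewrite /slice pushmE /mrestr; congr (m _); apply/seteqP.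
    by split => z /=; [move=> [? [? [? _]]]|move=> [? [? ?]]].
  rewrite -!E; apply: prod_measure_unique => // [|C D mC mD]; first exact: slice_fin.
  by rewrite !E; exact: mA.
have mZ B G : measurable B -> measurable G -> m1 (B `*` G) = m2 (B `*` G).
  move=> mB mG.
  pose K := B `*` [set: time * (E1 * E2)].
  have mK : measurable K by apply: measurableX.
  have E m G' : slice m mK measurable_snd G' = m (B `*` G').
    rewrite /slice pushmE /mrestr; congr (m _); apply/seteqP.
    by split => z /=; [move=> [? [? _]]|move=> [? ?]].
  rewrite -!E; apply: prod_measure_unique => // [|C D mC mD]; first exact: slice_fin.
  by rewrite !E; exact: mAF.
by move=> K mK; exact: prod_measure_unique.
Qed.

End step_law_uniqueness.

(** * Law of the trajectory sampled by the continuous-time process *)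

Section process.
Context {R : realType} {d : nat} {A : pmetricType R} (M : pdmdp d A).
Local Notation E := (state R d).
Local Notation time := (measurableTypeR R).
Variables (p : policyP d A) (q : policyD d A) (pq : corresponding p q).
Variables (lo hi : R) (lo_gt0 : 0 < lo)
  (lam_bounds : forall ya : 'rV[R]_d * A, lo <= lamA M ya <= hi).
Context {dO : measure_display} {Omega : measurableType dO}.
Variables (T : nat -> Omega -> R) (Yh X : nat -> Omega -> state R d).
Variables (x y : E) (P : probability Omega R).
Hypothesis PP : is_pdmdp_process M p T Yh X x y P.
Local Open Scope ereal_scope.

Fixpoint sample (n : nat) (w : Omega) : @traj R d n :=
  match n return @traj R d n with
  | 0 => (Yh 0%N w, X 0%N w)
  | m.+1 => (sample m w, (sojourn T m w, (Yh m.+1 w, X m.+1 w)))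
  end.

Lemma sample_ok n w : traj_ok (sample n w).
Proof.
elim: n => [//|n ih]; split => //=.
by rewrite /sojourn subr_ge0 ltW//; exact: (T_increasing PP).
Qed.

Lemma sample_last n w : traj_last (sample n w) = Yh n w.
Proof. by case: n. Qed.

Lemma sample_hist n w : Hproc p T X n w = traj_hist q (sample n w).
Proof.
elim: n => [//|n ih] /=; rewrite ih (relaxed_of_policy pq)//.
exact: traj_hist_space (sample_ok n w).
Qed.

Lemma sample_control n w : Rproc p T X n w = q n (traj_hist q (sample n w)).
Proof.
rewrite /Rproc sample_hist (relaxed_of_policy pq)//.
exact: traj_hist_space (sample_ok n w).
Qed.

Lemma measurable_sample n : measurable_fun setT (sample n).
Proof.
have mY := Yh_measurable PP; have mX := X_measurable PP; have mT := T_measurable PP.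
elim: n => [|n ih]; first exact: measurable_fun_pair.
suff : measurable_fun setT (fun w => (sample n w, (sojourn T n w, (Yh n.+1 w, X n.+1 w)))
    : (@traj R d n * (time * (E * E)))%type) by [].
apply: measurable_fun_pair => //; apply: measurable_fun_pair.
  exact: (measurable_funB (mT n.+1) (mT n)).
exact: measurable_fun_pair.
Qed.

Section past_determines_sample.
Variable N : nat.

(** Shows that events of the sampled trajectory belong to the past on which [jump_cond] conditions.
    The length N of the tuple stays fixed while n varies, so that the recursion can reread the same
    tuple. *)
Fixpoint traj_of_past (n : nat) (h : hist d A n) (ys : N.+1.-tuple E) : @traj R d n :=
  match n return hist d A n -> @traj R d n with
  | 0 => fun h => (tnth ys (inord 0), h)
  | m.+1 => fun h => (@traj_of_past m h.1.1.1 ys, (h.1.2, (tnth ys (inord m.+1), h.2)))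
  end h.

Lemma traj_of_pastE n w : (n <= N)%N ->
  traj_of_past (Hproc p T X n w) [tuple Yh k w | k < N.+1] = sample n w.
Proof.
elim: n => [|n ih] nN /=; first by rewrite tnth_mktuple inordK.
by rewrite ih 1?ltnW// tnth_mktuple inordK.
Qed.

Lemma measurable_traj_of_past n :
  measurable_fun setT (fun z : hist d A n * N.+1.-tuple E => traj_of_past z.1 z.2).
Proof.
elim: n => [|n ih].
  have mt : measurable_fun setT (fun z : E * N.+1.-tuple E => tnth z.2 (inord 0)).
    exact: (measurableT_comp (measurable_tnth _) measurable_snd).
  suff : measurable_fun setT (fun z : E * N.+1.-tuple E => (tnth z.2 (inord 0), z.1)
      : (E * E)%type) by [].
  by apply: measurable_fun_pair => //; exact: measurable_fst.
pose H := (hist d A n * relaxed A * time * E)%type.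
have mt : measurable_fun setT (fun z : H * N.+1.-tuple E => tnth z.2 (inord n.+1)).
  exact: (measurableT_comp (measurable_tnth _) measurable_snd).
have m1 : measurable_fun setT (fun z : H * N.+1.-tuple E => z.1.1).
  exact: (measurableT_comp measurable_fst measurable_fst).
have m0 : measurable_fun setT (fun z : H * N.+1.-tuple E => (z.1.1.1.1, z.2)).
  apply: measurable_fun_pair; last exact: measurable_snd.
  apply: (measurableT_comp measurable_fst); exact: (measurableT_comp measurable_fst m1).
suff : measurable_fun setT (fun z : H * N.+1.-tuple E =>
   (traj_of_past z.1.1.1.1 z.2, (z.1.1.2, (tnth z.2 (inord n.+1), z.1.2)))
     : (@traj R d n * (time * (E * E)))%type) by [].
apply: measurable_fun_pair; first exact: (measurableT_comp ih m0).
apply: measurable_fun_pair; first exact: (measurableT_comp measurable_snd m1).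
apply: measurable_fun_pair => //.
exact: (measurableT_comp measurable_snd measurable_fst).
Qed.

End past_determines_sample.

Local Notation N0 n := (@traj_stage_ker R d A M p q _ _ lo_gt0 lam_bounds _ (lexx 0%R) n).

Lemma jump_cond_sample n (B : set (@traj R d n)) (t : R) (C D : set E) :
  measurable B -> (0 <= t)%R -> measurable C -> measurable D ->
  P (sample n @^-1` B `&` [set w | [/\ (sojourn T n w <= t)%R, C (Yh n.+1 w) & D (X n.+1 w)]]) =
  \int[P]_(w in sample n @^-1` B)
    N0 n (sample n w) [set z | [/\ (z.2.1 <= t)%R, C z.2.2.1 & D z.2.2.2]].
Proof.
move=> mB t0 mC mD.
pose B' : set (hist d A n * n.+1.-tuple E) := (fun z => traj_of_past z.1 z.2) @^-1` B.
have mB' : measurable B'.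
  by rewrite -[X in measurable X]setTI; exact: (@measurable_traj_of_past n n measurableT _ mB).
have E' : past p T Yh X n @^-1` B' = sample n @^-1` B.
  by apply/seteqP; split => w; rewrite /B' /past /= traj_of_pastE.
rewrite -E' (jump_cond PP mB' t0 mC mD); apply: eq_integral => w _.
by rewrite sample_control -(sample_last n w); exact: (jump_lawE pq lo_gt0 lam_bounds (sample_ok n w)).
Qed.

Let unit_sample n : measurable_fun setT (fun z : unit * Omega => sample n z.2).
Proof. exact: (measurableT_comp (@measurable_sample n) measurable_snd). Qed.

Lemma sample_step n (F : @traj R d n.+1 -> \bar R) :
  (forall z, 0 <= F z) -> measurable_fun setT F ->
  \int[P]_w F (sample n.+1 w) = \int[P]_w \int[N0 n (sample n w)]_z F z.
Proof.
move=> F0 mF.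
pose m1 : {measure set (@traj R d n * (time * (E * E))) -> \bar R} :=
  pushm P (@measurable_sample n.+1).
(* Composing from [unit] makes the P-mixture of the kernels at [sample n w] a measure, which can be
   compared with the law of [sample n.+1]. *)
pose kP : R.-sfker unit ~> Omega := kconst P.
pose kN : R.-sfker (unit * Omega) ~> (@traj R d n * (time * (E * E)))%type :=
  sfkprecomp (N0 n) (@unit_sample n).
pose k2 : R.-sfker unit ~> (@traj R d n * (time * (E * E)))%type := mkcomp kP kN.
have k2E G : (forall z, 0 <= G z) -> measurable_fun setT G ->
    \int[k2 tt]_z G z = \int[P]_w \int[N0 n (sample n w)]_z G z.
  by move=> G0 mG; rewrite [LHS]integral_kcomp.
rewrite -(k2E F)//.
transitivity (\int[m1]_z F z).
  by rewrite ge0_integral_pushm.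
apply: eq_setfun_integral => K mK.
have m1P : m1 setT < +oo.
  by rewrite /m1 pushmE preimage_setT; exact: le_lt_trans (probability_le1 P measurableT) (ltry 1).
apply: step_measure_unique => // B C D t mB mC mD.
pose Z : set (@traj R d n * (time * (E * E))) :=
  [set z | [/\ (z.2.1 <= t)%R, C z.2.2.1 & D z.2.2.2]].
have ZE : B `*` (`]-oo, t]%classic `*` (C `*` D)) = [set z | B z.1] `&` Z.
  apply/seteqP; split => z /=; rewrite in_itv/=.
    by move=> [? [? [? ?]]]; split.
  by move=> [? [? ? ?]].
have mBZ : measurable (B `*` (`]-oo, t]%classic `*` (C `*` D))).
  by do 3 (apply: measurableX => //).
have mZ : measurable Z.
  rewrite (_ : Z = setT `*` (`]-oo, t]%classic `*` (C `*` D))); first by do 3 (apply: measurableX => //).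
  apply/seteqP; split => z /=; rewrite in_itv/=; first by move=> [? ? ?].
  by move=> [_ [? [? ?]]].
have mind (V : set (@traj R d n * (time * (E * E)))) : measurable V ->
   measurable_fun setT (fun z => (\1_V z : R)%:E).
  by move=> mV; apply/measurable_EFinP; exact: measurable_indic.
have i0 (V : set (@traj R d n * (time * (E * E)))) z : 0 <= (\1_V z : R)%:E by rewrite lee_fin.
have k2B : k2 tt (B `*` (`]-oo, t]%classic `*` (C `*` D))) =
    \int[P]_(w in sample n @^-1` B) N0 n (sample n w) Z.
  rewrite -[LHS]integral_indicT// [LHS]k2E//; last exact: mind.
  rewrite [RHS]integral_mkcond; apply: eq_integral => w _; rewrite patchE.
  rewrite [LHS](integral_stage_ker_fst lo_gt0 lam_bounds _ _ (lexx 0%R) (sample n w) (i0 _)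
      (mind _ mBZ)).
  case: ifPn => [/set_mem Bw|/negP Bw].
    rewrite -[RHS]integral_indicT//.
    rewrite [RHS](integral_stage_ker_fst lo_gt0 lam_bounds _ _ (lexx 0%R) (sample n w) (i0 _)
        (mind _ mZ)).
    apply: eq_integral => z _; rewrite ZE !indicE; congr ((nat_of_bool _)%:R)%:E.
    by apply/idP/idP => /set_mem /=; [move=> [_ ?]; exact/mem_set|move=> ?; exact/mem_set].
  rewrite integral0_eq// => z _; rewrite ZE indicE memNset// => -[Bw' _].
  by apply: Bw; exact: mem_set.
have m1B : m1 (B `*` (`]-oo, t]%classic `*` (C `*` D))) =
    P (sample n @^-1` B `&` [set w | [/\ (sojourn T n w <= t)%R, C (Yh n.+1 w) & D (X n.+1 w)]]).
  rewrite /m1 pushmE ZE; congr (P _).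
apply: etrans (esym k2B); clear k2E k2B.
(* [jump_cond] covers t >= 0. For negative t both sides vanish: sojourn times are positive, and the
   kernel does not charge negative times. *)
have [t0|t0] := leP 0%R t.
  rewrite m1B; have Jn := @jump_cond_sample n B t C D mB t0 mC mD.
  by rewrite Jn; reflexivity.
rewrite m1B (_ : _ `&` _ = set0) ?measure0; last first.
  rewrite -subset0 => w [_ [/= St _ _]].
  have S0 : (0 < sojourn T n w)%R by rewrite /sojourn subr_gt0; exact: (T_increasing PP n w).
  by have := lt_trans (lt_le_trans S0 St) t0; rewrite ltxx.
rewrite integral0_eq// => w _; apply/eqP; rewrite eq_le measure_ge0 andbT.
have N00 := stage_ker_traj_ok p q lo_gt0 lam_bounds (lexx 0%R) (sample_ok n w).
apply: le_trans (_ : N0 n (sample n w) (~` @traj_ok R d n.+1) <= 0); last by rewrite N00.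
apply: le_measure; rewrite ?inE//.
  by apply: measurableC; exact: (@measurable_traj_ok R d n.+1).
by move=> z [zt _ _] [_]; rewrite leNgt (le_lt_trans zt).
Qed.

End process.

(** * Discounted expectations along the process, and non-explosion *)

Section process_cost.
Context {R : realType} {d : nat} {A : pmetricType R} (M : pdmdp d A).
Local Notation E := (state R d).
Local Notation time := (measurableTypeR R).
Variables (p : policyP d A) (q : policyD d A) (pq : corresponding p q).
Variables (lo hi : R) (lo_gt0 : 0 < lo)
  (lam_bounds : forall ya : 'rV[R]_d * A, lo <= lamA M ya <= hi).
Context {dO : measure_display} {Omega : measurableType dO}.
Variables (T : nat -> Omega -> R) (Yh X : nat -> Omega -> state R d).
Variables (x y : E) (P : probability Omega R).
Hypothesis PP : is_pdmdp_process M p T Yh X x y P.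
Local Open Scope ereal_scope.
Local Notation N0 n := (@traj_stage_ker R d A M p q _ _ lo_gt0 lam_bounds _ (lexx 0%R) n).
Local Notation sample := (sample T Yh X).
Local Notation discounted_mean := (discounted_mean (M := M) p q lo_gt0 lam_bounds x).

Fixpoint traj_time n : @traj R d n -> R :=
  match n return @traj R d n -> R with
  | 0 => fun=> 0%R
  | m.+1 => fun w => (@traj_time m w.1 + w.2.1)%R
  end.

Lemma measurable_traj_time n : measurable_fun setT (@traj_time n : _ -> time).
Proof.
elim: n => [|n ih] /=; first exact: measurable_cst.
apply: measurable_funD; first exact: (measurableT_comp ih measurable_fst).
exact: (measurableT_comp measurable_fst measurable_snd).
Qed.

Lemma sample_time n w : traj_time (sample n w) = T n w.
Proof.
elim: n => [|n ih] /=; first by rewrite (T_zero PP).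
by rewrite ih /sojourn addrC subrK.
Qed.

Let T_ge0 n w : (0 <= T n w)%R.
Proof.
elim: n => [|n ih]; first by rewrite (T_zero PP).
by apply: (le_trans ih); apply: ltW; exact: (T_increasing PP).
Qed.

Let m_exp_time (b : R) n : measurable_fun setT (fun z : @traj R d n => (expR (- (b * traj_time z)))%:E).
Proof.
apply/measurable_EFinP; apply: measurableT_comp; first exact: measurable_expR.
apply: measurableT_comp => //; apply: measurable_funM => //; exact: measurable_traj_time.
Qed.

Let m_exp_step (b : R) n : measurable_fun setT
  (fun z : @traj R d n * (time * (E * E)) => (expR (- (b * z.2.1)))%:E).
Proof.
apply/measurable_EFinP; apply: measurableT_comp; first exact: measurable_expR.
apply: measurableT_comp => //; apply: measurable_funM => //.
exact: (measurableT_comp measurable_fst measurable_snd).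
Qed.

(** A factor known before the jump leaves the inner integral because the kernel reproduces its
    starting trajectory. *)
Lemma sample_step_factor n (g : @traj R d n -> \bar R)
    (F : @traj R d n * (time * (E * E)) -> \bar R) :
  (forall w, 0 <= g w) -> measurable_fun setT g ->
  (forall z, 0 <= F z) -> measurable_fun setT F ->
  \int[P]_w (g (sample n w) * F (sample n.+1 w)) =
  \int[P]_w (g (sample n w) * \int[N0 n (sample n w)]_z F z).
Proof.
move=> g0 mg F0 mF.
pose G (z : @traj R d n * (time * (E * E))) := g z.1 * F z.
have G0 z : 0 <= G z by rewrite /G mule_ge0.
have mG : measurable_fun setT G.
  by apply: emeasurable_funM => //; exact: (measurableT_comp mg measurable_fst).
transitivity (\int[P]_w G (sample n.+1 w)); first by [].
rewrite (sample_step pq lo_gt0 lam_bounds PP (F := G) G0 mG).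
apply: eq_integral => w _.
rewrite [LHS](integral_stage_ker_fst lo_gt0 lam_bounds _ _ (lexx 0%R) (sample n w) G0 mG).
rewrite [X in _ = _ * X](integral_stage_ker_fst lo_gt0 lam_bounds _ _ (lexx 0%R) (sample n w) F0 mF).
rewrite -ge0_integralZl//.
have mp : measurable_fun setT (fun z : @traj R d n * (time * (E * E)) => (sample n w, z.2)).
  by apply: measurable_fun_pair => //; exact: measurable_snd.
exact: (measurableT_comp mF mp).
Qed.

Lemma discounted_meanE n (f : @traj R d n -> \bar R) :
  (forall z, 0 <= f z) -> measurable_fun setT f ->
  \int[P]_w ((expR (- (discount M * T n w)))%:E * f (sample n w)) = discounted_mean f y.
Proof.
elim: n f => [|n ih] f f0 mf.
  transitivity (\int[P]_w f (y, x)).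
    apply: ge0_ae_eq_integral_nonmeas => //.
      by move=> w _; rewrite mule_ge0.
    (* The initial condition concerns Y at time 0; [post_jump] together with T_0 = 0 transfers it to
       the state [Yh 0]. *)
    have h : {ae P, forall w, Yproc M p T Yh X w 0 = y /\ X 0%N w = x}.
      by apply: filterS2 (Y_init PP) (X_init PP) => w.
    apply: ae_impl h => w [Yw Xw] _; rewrite (T_zero PP) mulr0 oppr0 expR0 mul1e /=.
    by rewrite (post_jump PP) (T_zero PP) Yw Xw.
  transitivity (f (y, x) * P setT); first exact: integral_cst.
  by rewrite probability_setT mule1.
have F0 (z : @traj R d n * (time * (E * E))) : 0 <= (expR (- (discount M * z.2.1)))%:E * f z.
  by rewrite mule_ge0// lee_fin expR_ge0.
have mF := emeasurable_funM (@m_exp_step (discount M) n) mf.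
transitivity (\int[P]_w ((expR (- (discount M * traj_time (sample n w))))%:E *
   ((expR (- (discount M * (sample n.+1 w).2.1)))%:E * f (sample n.+1 w)))).
  apply: eq_integral => w _; rewrite muleA -EFinM; congr (_%:E * _).
  by rewrite -expRD -sample_time /=; congr expR; ring.
rewrite (sample_step_factor (g := fun w => (expR (- (discount M * traj_time w)))%:E) _ _ F0 mF)//.
rewrite /= -ih; last 2 first.
- by move=> w; exact: integral_ge0.
- exact: measurable_stage_integral.
apply: eq_integral => w _; rewrite sample_time.
have D := integral_stage_ker_discount lo_gt0 lam_bounds (@measurable_traj_flow R d A M q n)
  (@measurable_traj_control R d A p q n) (discount_ge0 M) (sample n w) f0 mf.
exact: (congr1 (fun u => (expR (- (discount M * T n w)))%:E * u) (esym D)).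
Qed.

Let kappa : R := (1 - expR (- hi) * (1 - expR (- 1)))%R.

Let expN1 : (0 < expR (- 1 : R) < 1)%R.
Proof.
rewrite expR_gt0 /=; have : (expR (- 1) < expR 0 :> R)%R by rewrite ltr_expR; lra.
by rewrite expR0.
Qed.

Let hi_gt0 : (0 < hi)%R.
Proof.
have /andP[l1 l2] := lam_bounds (0%R, point).
exact: lt_le_trans lo_gt0 (le_trans l1 l2).
Qed.

Let kappa_bounds : (0 <= kappa < 1)%R.
Proof.
have /andP[e0 e1] := expN1.
have h0 : (0 < expR (- hi))%R by exact: expR_gt0.
have h1 : (expR (- hi) <= 1)%R by rewrite -expR0 ler_expR oppr_le0 ltW.
by rewrite /kappa; apply/andP; split; nra.
Qed.

Lemma expected_expN_time n : \int[P]_w (expR (- T n w))%:E <= (kappa ^+ n)%:E.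
Proof.
have /andP[k0 k1] := kappa_bounds.
elim: n => [|n ih].
  under eq_integral do rewrite (T_zero PP) oppr0 expR0.
  rewrite expr0; apply: le_trans (_ : 1 * P setT <= 1).
    by rewrite -integral_cst.
  by rewrite probability_setT mule1.
have F0 (z : @traj R d n * (time * (E * E))) : 0 <= (expR (- (1 * z.2.1)))%:E :> \bar R.
  by rewrite lee_fin expR_ge0.
apply: le_trans (_ : \int[P]_w (expR (- T n w))%:E * kappa%:E <= _); last first.
  by rewrite exprSr EFinM lee_pmul ?lee_fin//; apply: integral_ge0 => w _; rewrite lee_fin expR_ge0.
have E1 : \int[P]_w (expR (- T n.+1 w))%:E =
  \int[P]_w ((expR (- (1 * traj_time (sample n w))))%:E *
   (expR (- (1 * (sample n.+1 w).2.1)))%:E).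
  apply: eq_integral => w _; rewrite -EFinM -expRD -sample_time /=.
  by congr (expR _)%:E; ring.
rewrite E1 (sample_step_factor (g := fun w => (expR (- (1 * traj_time w)))%:E) _ _ F0
    (@m_exp_step 1 n))//.
have mT1 : measurable_fun setT (fun w => (expR (- T n w))%:E).
  by apply/measurable_EFinP; apply: measurableT_comp;
      [exact: measurable_expR|apply: measurableT_comp => //; exact: (T_measurable PP)].
have mI : measurable_fun setT (fun w => \int[N0 n (sample n w)]_z (expR (- (1 * z.2.1)))%:E).
  have mI : measurable_fun setT (fun v : @traj R d n => \int[N0 n v]_z (expR (- (1 * z.2.1)))%:E).
    exact: measurable_stage_integral.
  exact: (measurableT_comp mI (measurable_sample PP (n:=n))).
rewrite -ge0_integralZr//.
apply: ge0_le_integral => //.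
- by move=> w _; rewrite mule_ge0 ?lee_fin ?expR_ge0//; exact: integral_ge0.
- apply: emeasurable_funM => //.
  exact: (measurableT_comp (@m_exp_time 1 n) (measurable_sample PP (n:=n))).
- exact: emeasurable_funM.
move=> w _; rewrite mul1r sample_time lee_wpmul2l ?lee_fin ?expR_ge0//.
under eq_integral do rewrite mul1r.
exact: (stage_ker_expN_le lo_gt0 lam_bounds (@measurable_traj_flow R d A M q n)
  (@measurable_traj_control R d A p q n) (sample n w)).
Qed.

(** The paths with infinitely many jumps by time K. An explosive path lies in one of these countably
    many events. *)
Let bad (K : nat) : set Omega := \bigcap_n [set w | (T n w <= K%:R)%R].

Let measurable_bad K : measurable (bad K).
Proof.
apply: bigcapT_measurable => n.
have mt : measurable ([set u | (u <= K%:R)%R] : set time).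
  by rewrite -set_itvNyc; exact: measurable_itv.
by rewrite -[X in measurable X]setTI; exact: (T_measurable PP n measurableT mt).
Qed.

(** Markov's inequality: e^{-T_n} is at least e^{-K} on [bad K]. *)
Let bad_le K n : P (bad K) * (expR (- K%:R))%:E <= (kappa ^+ n)%:E.
Proof.
apply: le_trans (expected_expN_time n).
have mi : measurable_fun setT (fun w => (\1_(bad K) w : R)%:E).
  by apply/measurable_EFinP; exact: measurable_indic.
have -> : P (bad K) * (expR (- K%:R))%:E = \int[P]_w ((\1_(bad K) w)%:E * (expR (- K%:R))%:E).
  by rewrite ge0_integralZr// integral_indicT.
have mT1 : measurable_fun setT (fun w => (expR (- T n w))%:E).
  by apply/measurable_EFinP; apply: measurableT_comp;
      [exact: measurable_expR|apply: measurableT_comp => //; exact: (T_measurable PP)].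
apply: ge0_le_integral => //.
  exact: emeasurable_funM.
move=> w _; rewrite indicE -EFinM lee_fin.
have [/set_mem wK|_] := boolP (_ \in _); last by rewrite mul0r expR_ge0.
by rewrite mul1r ler_expR lerN2; exact: wK.
Qed.

Let bad0 K : P (bad K) = 0.
Proof.
have /andP[k0 k1] := kappa_bounds.
have Pfin : P (bad K) \is a fin_num by exact: fin_num_measure.
have r0 : (0 <= fine (P (bad K)))%R by exact: fine_ge0.
apply/eqP; rewrite -(fineK Pfin) eqe eq_le r0 andbT leNgt; apply/negP => rgt0.
have c0 : (0 < fine (P (bad K)) * expR (- K%:R))%R by rewrite mulr_gt0// expR_gt0.
(* The left side of [bad_le] does not depend on n, so a positive probability is contradicted by
   large n. *)
have : (fun n => kappa ^+ n)%R @ \oo --> (0 : R)%R by apply: cvg_expr; rewrite ger0_norm.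
move=> /cvgrPdist_lt /(_ _ c0)[n _ /(_ n (leqnn n))].
rewrite /= sub0r normrN ger0_norm ?exprn_ge0// => kn.
have := bad_le K n; rewrite -(fineK Pfin) -EFinM lee_fin => /le_lt_trans /(_ kn).
by rewrite ltxx.
Qed.

Lemma nonexplosion : {ae P, forall w, forall t : R, exists n, (t < T n w)%R}.
Proof.
exists (\bigcup_K bad K); split.
- exact: bigcupT_measurable.
- apply/eqP; rewrite eq_le measure_ge0 andbT.
  apply: le_trans (measure_sigma_subadditive _ _ _ (subset_refl _)) _ => //.
    exact: bigcupT_measurable.
  by rewrite eseries0// => K _ _; exact: bad0.
move=> w /= /existsNP[t /forallNP nt].
exists (Num.truncn `|t|).+1 => // n _ /=.
have /negP := nt n; rewrite -leNgt => /le_trans; apply; apply: (le_trans (ler_norm _)).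
exact/ltW/truncnS_gt.
Qed.

End process_cost.

(** * The cost of the process split over the intervals between jumps *)

Section cost_decomposition.
Context {R : realType} {d : nat} {A : pmetricType R} (M : pdmdp d A).
Local Notation E := (state R d).
Local Notation time := (measurableTypeR R).
Variables (p : policyP d A) (q : policyD d A) (pq : corresponding p q).
Variables (lo hi : R) (lo_gt0 : 0 < lo)
  (lam_bounds : forall ya : 'rV[R]_d * A, lo <= lamA M ya <= hi).
Context {dO : measure_display} {Omega : measurableType dO}.
Variables (T : nat -> Omega -> R) (Yh X : nat -> Omega -> state R d).
Variables (x y : E) (P : probability Omega R).
Hypothesis PP : is_pdmdp_process M p T Yh X x y P.
Local Open Scope ereal_scope.
Local Notation N0 n := (@traj_stage_ker R d A M p q _ _ lo_gt0 lam_bounds _ (lexx 0%R) n).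
Local Notation sample := (sample T Yh X).
Local Notation discounted_mean := (discounted_mean (M := M) p q lo_gt0 lam_bounds x).
Local Notation running_cost := (running_cost M p q).
Local Notation expected_cost := (expected_cost M p q).

Let T_mono w m n : (m <= n)%N -> (T m w <= T n w)%R.
Proof.
move=> /subnK <-; elim: (n - m)%N => [//|k ih].
by rewrite addSn (le_trans ih)// ltW//; exact: (T_increasing PP).
Qed.

Let T_ge0 w n : (0 <= T n w)%R.
Proof. by rewrite -(T_zero PP w); exact: T_mono. Qed.

Let slot w n : set time := `[T n w, T n.+1 w[%classic.

Let slotP w n t : slot w n t <-> (T n w <= t < T n.+1 w)%R.
Proof. by rewrite /slot /= in_itv. Qed.

Let slot_unique w m n t : slot w m t -> slot w n t -> m = n.
Proof.
wlog mn : m n / (m <= n)%N.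
  move=> W sm sn; have [mn|/ltnW nm] := leqP m n; first exact: W.
  exact/esym/W.
move=> /slotP/andP[_ tm] /slotP/andP[tn _]; apply/eqP.
rewrite eqn_leq mn leqNgt; apply/negP => mn'.
by have := lt_le_trans tm (le_trans (T_mono w mn') tn); rewrite ltxx.
Qed.

Let jump_indexE w n t : slot w n t -> jump_index T w t = n.
Proof.
move=> nt; apply: xget_unique; first by apply/slotP.
by move=> m /slotP mt; exact: slot_unique mt nt.
Qed.

Let cost_rate w (t : R) : \bar R := (expR (- (discount M * t)))%:E *
  \int[piproc p T X w t : probability (borel A) R]_a (cost M (Yproc M p T Yh X w t, a))%:E.

Let local_cost n (z : @traj R d n * time) : \bar R :=
  (expR (- (discount M * z.2)))%:E * running_cost z.

Let local_cost_ge0 n (z : @traj R d n * time) : 0 <= local_cost z.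
Proof. by rewrite /local_cost mule_ge0 ?lee_fin ?expR_ge0//; exact: running_cost_ge0. Qed.

Let measurable_local_cost n : measurable_fun setT (@local_cost n).
Proof.
apply: emeasurable_funM; last exact: measurable_running_cost.
apply/measurable_EFinP; apply: measurableT_comp; first exact: measurable_expR.
apply: measurableT_comp => //; apply: measurable_funM => //; exact: measurable_snd.
Qed.

Let cost_rateE w n t : slot w n t -> cost_rate w t =
  (expR (- (discount M * T n w)))%:E * local_cost (sample n w, (t - T n w)%R).
Proof.
move=> nt; have := nt => /slotP/andP[tn tn'].
have t0 : (0 <= t - T n w)%R by rewrite subr_ge0.
have ok := sample_ok PP n w.
rewrite /cost_rate /local_cost muleA -EFinM -expRD /=.
congr ((expR _)%:E * _); first by ring.
rewrite /piproc /Yproc (jump_indexE nt) (sample_control pq PP) (sample_hist pq PP) /running_cost.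
by rewrite traj_controlE// traj_flowE// sample_last.
Qed.

Let cost_rate_ge0 w t : 0 <= cost_rate w t.
Proof.
rewrite /cost_rate mule_ge0 ?lee_fin ?expR_ge0//.
by apply: integral_ge0 => a _; rewrite lee_fin; exact: cost_ge0.
Qed.

Let measurable_local_cost_at w n :
  measurable_fun setT (fun t : time => local_cost (sample n w, t)).
Proof. exact: (measurableT_comp (@measurable_local_cost n) (pair1_measurable (sample n w))). Qed.

Let measurable_cost_rate w n : measurable_fun (slot w n) (cost_rate w).
Proof.
apply: (eq_measurable_fun (fun t : time =>
   (expR (- (discount M * T n w)))%:E * local_cost (sample n w, (t - T n w)%R))).
  by move=> t /set_mem nt; rewrite (cost_rateE nt).
apply: measurable_funTS; apply: measurable_funeM.
have mt : measurable_fun setT (fun t : time => (t - T n w)%R : time) by exact: measurable_funB.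
exact: (measurableT_comp (@measurable_local_cost_at w n) mt).
Qed.

Lemma slot_cost w n : \int[leb]_(t in slot w n) cost_rate w t =
  (expR (- (discount M * T n w)))%:E *
  \int[leb]_(u in [set u : R | (0 <= u < sojourn T n w)%R]) local_cost (sample n w, u).
Proof.
transitivity (\int[leb]_(t in slot w n) ((expR (- (discount M * T n w)))%:E *
    local_cost (sample n w, (t - T n w)%R))).
  by apply: eq_integral => t /set_mem nt; rewrite (cost_rateE nt).
have mt : measurable_fun setT (fun t : time => (t - T n w)%R : time) by exact: measurable_funB.
have m1 : measurable_fun (slot w n) (fun t : time => local_cost (sample n w, (t - T n w)%R)).
  by apply: measurable_funTS; exact: (measurableT_comp (@measurable_local_cost_at w n) mt).
have e0 : 0 <= (expR (- (discount M * T n w)))%:E :> \bar R by rewrite lee_fin expR_ge0.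
apply: etrans (ge0_integralZl leb (measurable_itv _) m1 (fun t _ => local_cost_ge0 _) e0) _.
apply: (congr1 (fun u => (expR (- (discount M * T n w)))%:E * u)).
have m2 : measurable_fun (`[0%R, sojourn T n w[%classic : set time)
    (fun u : time => local_cost (sample n w, u)) by exact: measurable_funTS.
have tr := ge0_integral_translation (T n w) m2 (fun t _ => local_cost_ge0 _).
rewrite set_itvco in tr; rewrite -tr /slot.
by have -> : T n.+1 w = (T n w + sojourn T n w)%R by rewrite /sojourn addrC subrK.
Qed.

Lemma cost_split w : (forall t : R, exists n, (t < T n w)%R) ->
  \int[leb]_(t in Rge0) cost_rate w t = \sum_(0 <= n <oo) ((expR (- (discount M * T n w)))%:E *
    \int[leb]_(u in [set u : R | (0 <= u < sojourn T n w)%R]) local_cost (sample n w, u)).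
Proof.
move=> wT.
have -> : (Rge0 : set time) = \bigcup_n slot w n.
  apply/seteqP; split => [t t0|t [n _ /slotP/andP[nt _]]]; last exact: le_trans (T_ge0 w n) nt.
  have exn : exists n, (t < T n w)%R by exact: wT.
  (* The first jump after t is not the one of index 0, since T_0 = 0 <= t; the slot containing t
     therefore carries the preceding index. *)
  case: (ex_minnP exn) => -[|n] nt nmin.
    by move: nt; rewrite (T_zero PP) ltNge t0.
  exists n => //; apply/slotP; rewrite nt andbT leNgt; apply/negP => /nmin.
  by rewrite ltnn.
rewrite ge0_integral_bigcup//.
- by apply: eq_eseriesr => n _; exact: slot_cost.
- by move=> n; exact: measurable_itv.
- apply/measurable_fun_bigcup => // n; exact: measurable_itv.
- by move=> m n _ _ [t [mt nt]]; exact: slot_unique mt nt.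
Qed.

(** The cost between two jumps as a function of the trajectory extended by the second jump, the form
    to which [sample_step_factor] applies. *)
Let stage_cost_of n (z : @traj R d n * (time * (E * E))) : \bar R :=
  \int[leb]_(u in [set u : R | (0 <= u < z.2.1)%R]) local_cost (z.1, u).

Let stage_cost_of_ge0 n z : 0 <= @stage_cost_of n z.
Proof. exact: integral_ge0. Qed.

Let measurable_stage_cost_of n : measurable_fun setT (@stage_cost_of n).
Proof.
pose f (z : (@traj R d n * (time * (E * E))) * time) : \bar R :=
  (\1_[set z : (@traj R d n * (time * (E * E))) * time | (0 <= z.2)%R /\ (z.2 < z.1.2.1)%R] z)%:E *
  local_cost (z.1.1, z.2).
have f0 z : 0 <= f z by rewrite /f mule_ge0.
have m11 : measurable_fun setT (fun z : (@traj R d n * (time * (E * E))) * time => z.1.1).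
  exact: (measurableT_comp measurable_fst measurable_fst).
have m121 : measurable_fun setT (fun z : (@traj R d n * (time * (E * E))) * time => z.1.2.1).
  apply: (measurableT_comp measurable_fst); exact: (measurableT_comp measurable_snd measurable_fst).
have mf : measurable_fun setT f.
  apply: emeasurable_funM.
    apply/measurable_EFinP; apply: measurable_indic.
    apply: measurableI; rewrite -[X in measurable X]setTI.
      exact: measurable_fun_le.
    exact: (measurable_fun_ltr measurable_snd m121 measurableT (_ : measurable [set true])).
  have mp : measurable_fun setT (fun z : (@traj R d n * (time * (E * E))) * time => (z.1.1, z.2)).
    by apply: measurable_fun_pair => //; exact: measurable_snd.
  exact: (measurableT_comp (@measurable_local_cost n) mp).
have := @measurable_fun_fubini_tonelli_F _ _ _ _ _ leb f mf f0.
congr (measurable_fun _ _); apply/funext => z; rewrite /stage_cost_of integral_mkcond.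
apply: eq_integral => u _; rewrite patchE /f indicE /=.
case: ifPn => [/set_mem /= /andP[u0 ut]|/negP ut]; first by rewrite mem_set ?mul1e.
by rewrite memNset ?mul0e// => -[u0 ut']; apply: ut; apply: mem_set => /=; apply/andP.
Qed.

Lemma stage_expected_cost n :
  \int[P]_w ((expR (- (discount M * T n w)))%:E *
    \int[leb]_(u in [set u : R | (0 <= u < sojourn T n w)%R]) local_cost (sample n w, u)) =
  discounted_mean (@expected_cost n) y.
Proof.
rewrite -(discounted_meanE pq lo_gt0 lam_bounds PP (@expected_cost_ge0 _ _ _ M p q n)); last first.
  exact: (measurable_expected_cost p q lo_gt0 lam_bounds).
pose g (w : @traj R d n) : \bar R := (expR (- (discount M * traj_time w)))%:E.
have g0 w : 0 <= g w by rewrite lee_fin expR_ge0.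
have mg : measurable_fun setT g.
  apply/measurable_EFinP; apply: measurableT_comp; first exact: measurable_expR.
  apply: measurableT_comp => //; apply: measurable_funM => //; exact: measurable_traj_time.
transitivity (\int[P]_w (g (sample n w) * stage_cost_of (sample n.+1 w))).
  by apply: eq_integral => w _; rewrite /g (sample_time PP).
rewrite (sample_step_factor pq lo_gt0 lam_bounds PP g0 mg (@stage_cost_of_ge0 n)
    (@measurable_stage_cost_of n)).
apply: eq_integral => w _; rewrite /g (sample_time PP).
apply: (congr1 (fun u => (expR (- (discount M * T n w)))%:E * u)).
have B := integral_stage_ker_before_jump lo_gt0 lam_bounds (@measurable_traj_flow R d A M q n)
  (@measurable_traj_control R d A p q n) (sample n w)
  (fun u => local_cost_ge0 (sample n w, u)) (@measurable_local_cost_at w n).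
apply: etrans (integral_stage_ker_fst lo_gt0 lam_bounds (@measurable_traj_flow R d A M q n)
  (@measurable_traj_control R d A p q n) (lexx 0%R) (sample n w)
  (@stage_cost_of_ge0 n) (@measurable_stage_cost_of n)) _.
apply: (etrans B); apply: eq_integral => u _.
rewrite /local_cost muleA -EFinM -expRD; congr ((expR _)%:E * _).
by rewrite opprD addrC.
Qed.

Lemma process_costE :
  \int[P]_w \int[leb]_(t in Rge0) ((expR (- (discount M * t)))%:E *
    \int[piproc p T X w t]_a (cost M (Yproc M p T Yh X w t, a))%:E) =
  \sum_(0 <= n <oo) discounted_mean (@expected_cost n) y.
Proof.
pose h n w : \bar R := (expR (- (discount M * T n w)))%:E *
    \int[leb]_(u in [set u : R | (0 <= u < sojourn T n w)%R]) local_cost (sample n w, u).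
have h0 n w : 0 <= h n w.
  by rewrite /h mule_ge0 ?lee_fin ?expR_ge0//; exact: integral_ge0.
have mh n : measurable_fun setT (h n).
  apply: emeasurable_funM.
    apply/measurable_EFinP; apply: measurableT_comp; first exact: measurable_expR.
    apply: measurableT_comp => //; apply: measurable_funM => //; exact: (T_measurable PP).
  exact: (measurableT_comp (@measurable_stage_cost_of n) (measurable_sample PP (n := n.+1))).
transitivity (\int[P]_w \sum_(0 <= n <oo) h n w).
  (* The path cost on the left is not known to be measurable in w; it equals the measurable series
     on every non-explosive path. *)
  apply: ge0_ae_eq_integral_nonmeas.
  - by move=> w _; apply: integral_ge0 => t _; exact: cost_rate_ge0.
  - by move=> w _; apply: nneseries_ge0.
  by apply: ae_impl (nonexplosion pq lo_gt0 lam_bounds PP) => w wT _; exact: cost_split.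
rewrite integral_nneseries//; apply: eq_eseriesr => n _; exact: stage_expected_cost.
Qed.

End cost_decomposition.

Theorem lemma4p2 (R : realType) (d : nat) (A : pmetricType R)
    (compactA : compact [set: A]) (M : pdmdp d A)
    (p : policyP d A) (q : policyD d A) (pq : corresponding p q)
    (dO : measure_display) (Omega : measurableType dO)
    (T : nat -> Omega -> R) (Yh X : nat -> Omega -> state R d)
    (P : state R d -> state R d -> probability Omega R)
    (PP : forall x y : state R d,
      is_pdmdp_process M p T Yh X x y (P x y))
    (x : state R d) :
  J M p T Yh X P x = Jtilde M q x.
Proof.
have [lo [hi [lo_gt0 _ lam_bounds]]] := lamA_bounds M.
rewrite (JtildeE pq lo_gt0 lam_bounds); apply: eq_integral => y _.
exact: (process_costE pq lo_gt0 lam_bounds (PP x y)).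
Qed.
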